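(* Let $\psi\in\mathcal{C}$ be $C^2$ on $\Delta_n$ with $\psi|_{\partial\Delta_n}\equiv0$. Then $$\mathrm{vol}(\widehat{R}(\psi))=\frac1n\int_{D_{n-1}}\psi(q)\det(-D^2\psi(q))\,dq$$ (an identity in $[0,\infty]$; $\widehat{R}(\psi)$ is not assumed bounded).
   Context: Let $n\ge2$, $\mathbb{R}_+^n:=(0,\infty)^n$, $\Delta_n:=\{p\in(0,1)^n:p_1+\cdots+p_n=1\}$, $\overline{\Delta}_n$ its closure, $\partial\Delta_n=\overline{\Delta}_n\setminus\Delta_n$, $\langle p,x\rangle=\sum_ip_ix_i$. $\mathcal{C}:=\{\psi:\overline{\Delta}_n\to[0,\infty)\text{ continuous and concave}\}$. For $p\in\Delta_n$, $a\ge0$, $R(p,a):=\{x\in\mathbb{R}_+^n:\langle p,x\rangle<a\}$, and $\widehat{R}(\psi):=\bigcup_{p\in\Delta_n}R(p,\psi(p))$; $\mathrm{vol}$ is Lebesgue measure on $\mathbb{R}^n$. $D_{n-1}:=\{(q_1,\dots,q_{n-1})\in(0,1)^{n-1}:\sum_{i=1}^{n-1}q_i<1\}$. A function $\psi\in\mathcal{C}$ is also regarded as a function on $D_{n-1}$ by $\psi(q_1,\dots,q_{n-1})=\psi(q_1,\dots,q_{n-1},1-\sum_{i=1}^{n-1}q_i)$, and $D^2\psi(q)$ is its $(n-1)\times(n-1)$ Hessian matrix in the variable $q$. *)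

(* Defs.v *)
From HB Require Import structures.
From mathcomp Require Import all_boot all_order all_algebra.
From mathcomp Require Import all_classical all_reals all_analysis.
Set Implicit Arguments.
Unset Strict Implicit.
Unset Printing Implicit Defensive.
Import Order.TTheory GRing.Theory Num.Theory.
Import numFieldNormedType.Exports.
Local Open Scope classical_set_scope.
Local Open Scope ring_scope.

Definition measure_rV_display : measure_display.
Proof. exact: default_measure_display. Qed.

(* The sigma-algebra on R^n generated by the coordinate functions, i.e. the
   Borel sigma-algebra (same construction as the library's on n.-tuple T). *)
Section measurable_rV.
Context {R : realType} (n : nat).

Definition rV_coord (i : 'I_n) (x : 'rV[R]_n) : measurableTypeR R := x ord0 i.

Let rV_set0 : g_sigma_preimage rV_coord set0.
Proof. exact: sigma_algebra0. Qed.

Let rV_setC A : g_sigma_preimage rV_coord A -> g_sigma_preimage rV_coord (~` A).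
Proof. exact: sigma_algebraC. Qed.

Let rV_bigcup (F : (set _)^nat) : (forall i, g_sigma_preimage rV_coord (F i)) ->
  g_sigma_preimage rV_coord (\bigcup_i (F i)).
Proof. exact: sigma_algebra_bigcup. Qed.

HB.instance Definition _ := @isMeasurable.Build measure_rV_display
  'rV[R]_n (g_sigma_preimage rV_coord) rV_set0 rV_setC rV_bigcup.

Lemma measurable_rV_coord (i : 'I_n) : measurable_fun setT (rV_coord i).
Proof.
move=> _ Y mY; rewrite setTI; apply: sub_sigma_algebra => /=.
rewrite -bigcup_seq/=; exists i => /=; first by rewrite mem_index_enum.
by exists Y => //; rewrite setTI.
Qed.

Lemma measurable_fun_rV d (T : measurableType d) (f : T -> 'rV[R]_n) :
  (forall i, measurable_fun setT (rV_coord i \o f)) -> measurable_fun setT f.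
Proof.
move=> mf.
suff : g_sigma_preimage (fun i => rV_coord i \o f) `<=` measurable.
  by rewrite g_sigma_preimage_comp => sub _ A mA; apply: sub; exists A.
apply: smallest_sub; first exact: sigma_algebra_measurable.
rewrite -bigcup_seq; apply: bigcup_sub => i _ A [B mB <-]; exact: mf.
Qed.

End measurable_rV.

Section lebesgue_rV.
Context {R : realType}.

Definition rV_cons n (u : measurableTypeR R * 'rV[R]_n) : 'rV[R]_n.+1 :=
  row_mx (u.1)%:M u.2.

Definition rV_uncons n (x : 'rV[R]_n.+1) : measurableTypeR R * 'rV[R]_n :=
  (x ord0 ord0, \row_i x ord0 (lift ord0 i)).

Lemma rV_cons0 n (u : measurableTypeR R * 'rV[R]_n) :
  rV_cons u ord0 ord0 = u.1.
Proof.
rewrite /rV_cons mxE; case: split_ordP => j /(congr1 val)//= _.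
by rewrite !ord1 mxE eqxx mulr1n.
Qed.

Lemma rV_consS n (u : measurableTypeR R * 'rV[R]_n) (i : 'I_n) :
  rV_cons u ord0 (lift ord0 i) = u.2 ord0 i.
Proof.
rewrite /rV_cons mxE; case: split_ordP => j /(congr1 val)/=.
  by rewrite ord1 /bump leq0n.
by rewrite /bump leq0n !add1n => -[/val_inj ->].
Qed.

Lemma rV_consK n : cancel (@rV_cons n) (@rV_uncons n).
Proof.
move=> [a v]; rewrite /rV_uncons rV_cons0/=; congr pair.
by apply/rowP => i; rewrite mxE rV_consS.
Qed.

Lemma measurable_rV_cons n : measurable_fun setT (@rV_cons n).
Proof.
apply: measurable_fun_rV => i; have [j ->|->] := unliftP ord0 i.
- rewrite (_ : _ \o _ = rV_coord j \o snd); last first.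
    by apply/funext => u; rewrite /= /rV_coord rV_consS.
  by apply: measurableT_comp => //; exact: measurable_rV_coord.
- rewrite (_ : _ \o _ = fst)//.
  by apply/funext => u; rewrite /= /rV_coord rV_cons0.
Qed.

Lemma measurable_rV_uncons n : measurable_fun setT (@rV_uncons n).
Proof.
apply: measurable_fun_pair; first exact: (@measurable_rV_coord R n.+1 ord0).
apply: measurable_fun_rV => i.
rewrite (_ : _ \o _ = rV_coord (lift ord0 i)); first exact: measurable_rV_coord.
by apply/funext => x; rewrite /= /rV_coord mxE.
Qed.

Section step.
Variables (n : nat) (mu : {sigma_finite_measure set 'rV[R]_n -> \bar R}).

Definition lebesgue_rV_step : set 'rV[R]_n.+1 -> \bar R :=
  pushforward (lebesgue_measure \x mu)%E (@rV_cons n).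

Let lebesgue_rV_step0 : lebesgue_rV_step set0 = 0%E.
Proof. by rewrite /lebesgue_rV_step /pushforward preimage_set0 measure0. Qed.

Let lebesgue_rV_step_ge0 A : (0 <= lebesgue_rV_step A)%E.
Proof. by rewrite /lebesgue_rV_step /pushforward measure_ge0. Qed.

Let lebesgue_rV_step_sigma_additive : semi_sigma_additive lebesgue_rV_step.
Proof.
move=> F mF tF mUF.
have mpre B : measurable B -> measurable (@rV_cons n @^-1` B).
  by move=> mB; rewrite -[X in measurable X]setTI; exact: measurable_rV_cons.
rewrite /lebesgue_rV_step /pushforward preimage_bigcup.
apply: measure_semi_sigma_additive.
- by move=> i; exact: mpre.
- apply/trivIsetP => i j _ _ ij; rewrite -preimage_setI.
  by move/trivIsetP : tF => /(_ _ _ _ _ ij) ->//; rewrite preimage_set0.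
- by rewrite -preimage_bigcup; exact: mpre.
Qed.

HB.instance Definition _ := isMeasure.Build _ _ _ lebesgue_rV_step
  lebesgue_rV_step0 lebesgue_rV_step_ge0 lebesgue_rV_step_sigma_additive.

Let lebesgue_rV_step_sigma_finite : sigma_finite setT lebesgue_rV_step.
Proof.
have [F TF mF] : sigma_finite setT (lebesgue_measure \x mu)%E.
  have /sigma_finiteP[F [TF ndF Foo]] := sigma_finiteT (@lebesgue_measure R).
  have /sigma_finiteP[G [TG ndG Goo]] := sigma_finiteT mu.
  exists (fun k => F k `*` G k).
    rewrite -setXTT TF TG predeqE => -[x y]; split.
      move=> [/= [k _ Fkx] [l _ Gly]]; exists (maxn k l) => //; split.
      - by move: x Fkx; exact/subsetPset/ndF/leq_maxl.
      - by move: y Gly; exact/subsetPset/ndG/leq_maxr.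
    by move=> [k _ []/= ? ?]; split; exists k.
  move=> k; have [? ?] := Foo k; have [? ?] := Goo k.
  split; first exact: measurableX.
  by rewrite product_measure1E// lte_mul_pinfty// ge0_fin_numE.
exists (fun k => @rV_uncons n @^-1` F k).
  by rewrite -preimage_bigcup -TF preimage_setT.
move=> k; have [mFk Fkoo] := mF k; split.
  by rewrite -[X in measurable X]setTI; exact: measurable_rV_uncons.
rewrite /lebesgue_rV_step /pushforward -comp_preimage.
by rewrite (_ : _ \o _ = id) ?preimage_id//; apply/funext => u; exact: rV_consK.
Qed.

HB.instance Definition _ := Measure_isSigmaFinite.Build _ _ _ lebesgue_rV_step
  lebesgue_rV_step_sigma_finite.

End step.

(* Lebesgue measure on the Borel sets of R^n, as an iterated product measure. *)
Fixpoint lebesgue_rV n : {sigma_finite_measure set 'rV[R]_n -> \bar R} :=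
  match n with
  | 0 => \d_(0 : 'rV[R]_0)
  | m.+1 => lebesgue_rV_step (lebesgue_rV m)
  end.

Lemma lebesgue_rV_box n (A : 'I_n -> set (measurableTypeR R)) :
  (forall i, measurable (A i)) ->
  lebesgue_rV n [set x | forall i, A i (x ord0 i)] =
  (\prod_(i < n) lebesgue_measure (A i))%E.
Proof.
elim: n A => [|n IH] A mA.
  by rewrite big_ord0 /= diracE mem_set// => -[].
rewrite big_ord_recl -IH//.
have mB : measurable
    [set v : 'rV[R]_n | forall i, A (lift ord0 i) (v ord0 i)].
  rewrite (_ : [set _ | _] =
      \bigcap_(i in [set: 'I_n]) (rV_coord i @^-1` A (lift ord0 i))).
    apply: fin_bigcap_measurable => // i _; rewrite -[X in measurable X]setTI.
    exact: measurable_rV_coord.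
  by apply/seteqP; split => x /= h i; [move=> _|]; exact: h.
rewrite /= /lebesgue_rV_step /pushforward -product_measure1E//.
congr product_measure1; apply/seteqP; split => -[a v] /=.
  by move=> h; split => [|i]; [have := h ord0|have := h (lift ord0 i)];
    rewrite ?rV_cons0 ?rV_consS.
move=> [h0 hS] i; have [j ->|->] := unliftP ord0 i.
  by rewrite rV_consS; exact: hS.
by rewrite rV_cons0.
Qed.

End lebesgue_rV.

Unset Implicit Arguments.

Section simplex.
Context {R : realType}.

Definition dotr {n : nat} (p x : 'rV[R]_n) : R := \sum_i p ord0 i * x ord0 i.

Definition posorthant (n : nat) : set 'rV[R]_n :=
  [set x | forall i, 0 < x ord0 i].

Definition simplex (n : nat) : set 'rV[R]_n :=
  [set p | (forall i, 0 < p ord0 i < 1) /\ \sum_i p ord0 i = 1].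

Definition csimplex (n : nat) : set 'rV[R]_n := closure (simplex n).

Definition bsimplex (n : nat) : set 'rV[R]_n := csimplex n `\` simplex n.

(* Only the values of psi on the closed simplex matter. *)
Definition classC {n : nat} (psi : 'rV[R]_n -> R) : Prop :=
  [/\ forall p, csimplex n p -> 0 <= psi p,
      {within csimplex n, continuous psi} &
      convex_function (csimplex n) (fun p => - psi p)].

Definition region {n : nat} (p : 'rV[R]_n) (a : R) : set 'rV[R]_n :=
  [set x | posorthant n x /\ dotr p x < a].

Definition Rhat {n : nat} (psi : 'rV[R]_n -> R) : set 'rV[R]_n :=
  \bigcup_(p in simplex n) region p (psi p).

Definition chart_dom (m : nat) : set 'rV[R]_m :=
  [set q | (forall i, 0 < q ord0 i < 1) /\ \sum_i q ord0 i < 1].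

(* (q_1, ..., q_(n-1)) |-> (q_1, ..., q_(n-1), 1 - q_1 - ... - q_(n-1)) *)
Definition chart {n : nat} (q : 'rV[R]_n.-1) : 'rV[R]_n :=
  \row_(i < n) oapp (fun j : 'I_n.-1 => q ord0 j) (1 - \sum_j q ord0 j)
                    (insub (val i)).

Definition in_chart {n : nat} (psi : 'rV[R]_n -> R) (q : 'rV[R]_n.-1) : R :=
  psi (chart q).

End simplex.

Set Implicit Arguments.

Section C2.
Context {R : realType} (m : nat).
Implicit Types (f : 'rV[R]_m -> R) (U : set 'rV[R]_m).

Definition partial (i : 'I_m) f : 'rV[R]_m -> R := 'D_(delta_mx ord0 i) f.

(* Meant for open U. *)
Definition C1on U f : Prop :=
  forall i, (forall x, U x -> derivable f x (delta_mx ord0 i)) /\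
            (forall x, U x -> {for x, continuous (partial i f)}).

Definition C2on U f : Prop := C1on U f /\ forall i, C1on U (partial i f).

Definition hessian f (x : 'rV[R]_m) : 'M[R]_m :=
  \matrix_(i, j) partial i (partial j f) x.

End C2.

(* Main.v *)
Require Import Defs.
From HB Require Import structures.
From mathcomp Require Import all_boot all_order all_algebra.
From mathcomp Require Import all_classical all_reals all_analysis.
From mathcomp Require Import perm measurable_realfun ring lra.
Import Order.TTheory GRing.Theory Num.Theory.
Import numFieldNormedType.Exports.
Local Open Scope classical_set_scope.
Local Open Scope ring_scope.
Set Implicit Arguments.
Unset Strict Implicit.
Unset Printing Implicit Defensive.

(** Write m = n - 1, let f be psi in the chart, D the chart domain, and put
    L(s, y) = max of s psi(p) - <p', y> over the closed simplex, where p' are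
    the first m coordinates of p.

    Slicing.  In the coordinates x = (y_1 + z, ..., y_m + z, z) one has
    <p, x> = z + <p', y> on the simplex, so a point lies in the region of
    s psi exactly when L(0, y) < z < L(s, y).  Hence [volume_Rhat]: the region
    of s psi has volume the integral of L(s, y) - L(0, y) over y.  This region
    is also s times the region of psi ([Rhat_scale]), so its volume is s^n V.

    Difference quotients.  L(., y) is convex, with slope psi(p) at a maximizer
    p.  If psi(p) > 0, then p is interior because psi vanishes on the boundary,
    and then y is the gradient of f at p'.  So (L(1, y) - L(s, y)) / (1 - s) is
    for 0 <= s < 1 at most f(q) at y = grad f(q), and zero at every other y, while
    for s > 1 it is at least f(q) at y = grad f(q).  No limit is taken here:
    these bounds hold for each s.

    Change of variables y = grad f(q).  Its Jacobian is the Hessian; concavity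
    gives det (- D^2 f) >= 0 ([det_hessian]) and makes the gradient injective
    where this determinant does not vanish ([grad_injective]).  With
    beta = integral over D of f det (- D^2 f), the inequalities [area_upper]
    and [area_lower] turn the pointwise bounds into
      (1 - s^n) V <= (1 - s) beta  for s < 1,
      (s - 1) beta <= (s^n - 1) V  for s > 1,
    and s -> 1 gives beta = n V ([volume_formula]).  Taking s = 0 gives
    V <= beta, which settles the case of infinite V.

    The area inequalities hold for any C^1 map.  Near a point it is almost
    linear, so it maps a small cube into a set of volume about |det| times that
    of the cube, even where det = 0 (this contains Sard's theorem), and onto
    such a set where det is not zero (contraction principle).  These local
    comparisons become global by repeatedly halving cubes ([cube_induction]):
    a global failure would persist in nested cubes shrinking to a point. *)

(** * Linear maps and Lebesgue measure *)

Section linear_change.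
Context {R : realType}.

(** Stated with preimages, so that measurability comes for free and such maps
    compose; for an invertible linear map, c is the absolute value of the
    determinant. *)
Definition scales_measure d (T : measurableType d) (mu : set T -> \bar R)
    (phi : T -> T) (c : R) :=
  measurable_fun setT phi /\
  forall A, measurable A -> (c%:E * mu (phi @^-1` A) = mu A)%E.

Lemma measurable_preimageT d d' (T : measurableType d) (T' : measurableType d')
    (phi : T -> T') (A : set T') :
  measurable_fun setT phi -> measurable A -> measurable (phi @^-1` A).
Proof. by move=> mphi mA; rewrite -[X in measurable X]setTI; exact: mphi. Qed.

Lemma scales_measure_comp d (T : measurableType d) (mu : set T -> \bar R)
    (phi psi : T -> T) (c e : R) :
  scales_measure mu phi c -> scales_measure mu psi e ->
  scales_measure mu (psi \o phi) (e * c).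
Proof.
move=> [mphi phiE] [mpsi psiE]; split; first exact: measurableT_comp.
move=> A mA; rewrite comp_preimage EFinM -muleA phiE ?psiE//.
exact: measurable_preimageT.
Qed.

Lemma lebesgue_measure_affine (a t : R) : a != 0 ->
  scales_measure (@lebesgue_measure R)
    ((fun x => a * x + t) : measurableTypeR R -> measurableTypeR R) `|a|.
Proof.
move=> a0; pose phi : measurableTypeR R -> measurableTypeR R := fun x => a * x + t.
rewrite -/phi.
have mphi : measurable_fun setT phi.
  by apply: measurable_funD => //; exact: measurable_funM.
split=> // A mA.
pose nu : {measure set (measurableTypeR R) -> \bar R} :=
  @measure_function_pushforward__canonical__measure_function_Measure
    _ _ _ _ _ lebesgue_measure phi mphi.
pose mu : {measure set (measurableTypeR R) -> \bar R} :=
  @mscale _ _ _ (NngNum (normr_ge0 a)) nu.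
rewrite -[RHS](_ : mu A = _)//; last first.
  apply/esym/lebesgue_measure_unique => // X /ocitvP[->|[[x y] /= xy ->]].
    by rewrite !measure0.
  rewrite /= /mscale /pushforward/= lebesgue_measure_itv/= lte_fin xy.
  have [a_gt0|a_lt0|] := ltgtP 0 a; last by move/eqP; rewrite eq_sym (negbTE a0).
  - rewrite [X in (_ * X)%E](_ : _ =
        lebesgue_measure (`](x - t) / a, (y - t) / a]%classic : set R)); last first.
      congr lebesgue_measure; apply/seteqP; split => z /=; rewrite /phi !in_itv/=;
        rewrite ltr_pdivrMr// ler_pdivlMr//.
        by move=> /andP[? ?]; apply/andP; split; lra.
      by move=> /andP[? ?]; apply/andP; split; lra.
    rewrite lebesgue_measure_itv/= lte_fin ltr_pM2r ?invr_gt0// ltrD2r xy.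
    by rewrite -EFinD -EFinM gtr0_norm//; congr EFin; field.
  - rewrite [X in (_ * X)%E](_ : _ =
        lebesgue_measure (`[(y - t) / a, (x - t) / a[%classic : set R)); last first.
      congr lebesgue_measure; apply/seteqP; split => z /=; rewrite /phi !in_itv/=;
        rewrite ltr_ndivlMr// ler_ndivrMr//.
        by move=> /andP[? ?]; apply/andP; split; lra.
      by move=> /andP[? ?]; apply/andP; split; lra.
    rewrite lebesgue_measure_itv/= lte_fin ltr_nM2r ?invr_lt0// ltrD2r xy.
    by rewrite -EFinD -EFinM ltr0_norm//; congr EFin; field.
Qed.

Section product.
Context d2 (T2 : measurableType d2) (mu : {sigma_finite_measure set T2 -> \bar R}).
Let leb := @lebesgue_measure R.

Lemma product_measure21 (A : set (measurableTypeR R * T2)) : measurable A ->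
  (leb \x mu)%E A = (leb \x^ mu)%E A.
Proof.
move=> mA; apply: product_measure_unique => // *; exact: product_measure2E.
Qed.

(** A shear along the first factor acts on every horizontal slice as an affine
    map of the line with the same slope: integrate over the slices. *)
Lemma scales_product_fst (a : R) (g : T2 -> measurableTypeR R) : a != 0 ->
  measurable_fun setT g ->
  scales_measure (leb \x mu)%E (fun u => (a * u.1 + g u.2 : measurableTypeR R, u.2)) `|a|.
Proof.
move=> a0 mg; set h := (X in scales_measure _ X).
have mh : measurable_fun setT h.
  apply: measurable_fun_pair => /=; last exact: measurable_snd.
  apply: measurable_funD; last exact: measurableT_comp.
  by apply: measurable_funM => //; exact: measurable_fst.
split => // A mA.
have mhA := measurable_preimageT mh mA.
rewrite !product_measure21// /(_ \x^ _)%E/= -ge0_integralZl//; last first.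
  exact: measurable_fun_ysection.
apply: eq_integral => y _.
have [_ /(_ (ysection A y))] := lebesgue_measure_affine (g y) a0.
move=> E; rewrite /= -[RHS]E; last exact: measurable_ysection.
by [].
Qed.

Lemma scales_product_snd (phi : measurableTypeR R -> T2 -> T2) (c : R) : 0 <= c ->
  measurable_fun setT (fun u : measurableTypeR R * T2 => phi u.1 u.2) ->
  (forall x, scales_measure mu (phi x) c) ->
  scales_measure (leb \x mu)%E (fun u => (u.1, phi u.1 u.2)) c.
Proof.
move=> c0 mphi phic; set h := (X in scales_measure _ X).
have mh : measurable_fun setT h.
  by apply: measurable_fun_pair => //=; exact: measurable_fst.
split => // A mA.
have mhA := measurable_preimageT mh mA.
rewrite /(_ \x _)%E/= -ge0_integralZl//; last first.
  exact: measurable_fun_xsection.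
apply: eq_integral => x _.
have [_ /(_ (xsection A x))] := phic x.
move=> E; rewrite /= -[RHS]E; last exact: measurable_xsection.
by [].
Qed.

End product.

Notation leb := lebesgue_rV.

Lemma scales_rV_cons n (h : measurableTypeR R * 'rV[R]_n -> measurableTypeR R * 'rV[R]_n) c :
  scales_measure (lebesgue_measure \x leb n)%E h c ->
  scales_measure (leb n.+1) (@rV_cons R n \o h \o @rV_uncons R n) c.
Proof.
move=> [mh hc]; split.
  apply: measurableT_comp; last exact: measurable_rV_uncons.
  by apply: measurableT_comp => //; exact: measurable_rV_cons.
move=> A mA.
rewrite /= /lebesgue_rV_step /pushforward /= -[RHS]hc; last first.
  by apply: measurable_preimageT => //; exact: measurable_rV_cons.
congr (_ * product_measure1 _ _ _)%E.
by apply/funext => u; rewrite /preimage /= rV_consK.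
Qed.

Lemma measurable_fun_mulmxr m n (L : 'M[R]_(m, n)) :
  measurable_fun setT (fun v : 'rV[R]_m => v *m L).
Proof.
apply: measurable_fun_rV => j.
rewrite (_ : _ \o _ = fun v : 'rV[R]_m => \sum_i v ord0 i * L i j); last first.
  by apply/funext => v; rewrite /= /rV_coord mxE.
apply: measurable_sum => i; apply: measurable_funM => //.
exact: measurable_rV_coord.
Qed.

Lemma measurable_funD_rV d (T : measurableType d) n (f g : T -> 'rV[R]_n) :
  measurable_fun setT f -> measurable_fun setT g ->
  measurable_fun setT (fun x => f x + g x).
Proof.
move=> mf mg; apply: measurable_fun_rV => i.
rewrite (_ : _ \o _ = fun x => rV_coord i (f x) + rV_coord i (g x)); last first.
  by apply/funext => x; rewrite /= /rV_coord mxE.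
by apply: measurable_funD; apply: measurableT_comp => //; exact: measurable_rV_coord.
Qed.

Lemma lebesgue_rV_translate n (t : 'rV[R]_n) :
  scales_measure (leb n) (fun x => x + t) 1.
Proof.
elim: n t => [t|n IH t].
  rewrite (_ : (fun _ => _) = idfun); first by
    split => [|A mA]; [exact: measurable_id|rewrite mul1e preimage_id].
  by apply/funext => x; rewrite !thinmx0.
pose t0 := (rV_uncons t).1; pose t' := (rV_uncons t).2.
pose h1 (u : measurableTypeR R * 'rV[R]_n) : measurableTypeR R * 'rV[R]_n :=
  (1 * u.1 + t0, u.2).
pose h2 (u : measurableTypeR R * 'rV[R]_n) : measurableTypeR R * 'rV[R]_n :=
  (u.1, u.2 + t').
have h1P : scales_measure (lebesgue_measure \x leb n)%E h1 1.
  by rewrite -[X in scales_measure _ _ X]normr1;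
    apply: (@scales_product_fst _ _ (leb n) 1 (fun=> t0)); rewrite ?oner_neq0.
have h2P : scales_measure (lebesgue_measure \x leb n)%E h2 1.
  apply: (@scales_product_snd _ _ (leb n) (fun _ v => v + t') 1) => //.
  by apply: measurable_funD_rV => //; exact: measurable_snd.
have := scales_rV_cons (scales_measure_comp h1P h2P).
rewrite mulr1; congr (scales_measure _ _ _); apply/funext => x/=.
apply/rowP => i; have [j ->|->] := unliftP ord0 i.
  by rewrite rV_consS /= !mxE.
by rewrite rV_cons0 /= !mxE mul1r.
Qed.

Lemma rV_unconsK n : cancel (@rV_uncons R n) (@rV_cons R n).
Proof.
move=> x; apply/rowP => i; have [j ->|->] := unliftP ord0 i.
  by rewrite rV_consS /= mxE.
by rewrite rV_cons0.
Qed.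

(** Blocks are arranged so that row vectors split as in [rV_cons]. *)
Definition bordered n (a : R) (b : 'rV[R]_n) (c : 'cV[R]_n) (M : 'M[R]_n) :
  'M[R]_n.+1 := @block_mx R 1 n 1 n a%:M b c M.

Lemma mulmx_rV_cons n (u : measurableTypeR R * 'rV[R]_n)
    (a : R) (b : 'rV[R]_n) (c : 'cV[R]_n) (M : 'M[R]_n) :
  rV_cons u *m bordered a b c M =
  rV_cons (a * u.1 + (u.2 *m c) ord0 ord0 : measurableTypeR R, u.1 *: b + u.2 *m M).
Proof.
rewrite /rV_cons /bordered (@mul_row_block _ 1 1 n 1 n) /= !mul_scalar_mx.
rewrite [u.2 *m c]mx11_scalar scale_scalar_mx -raddfD /= [u.1 * a]mulrC.
by rewrite [(u.2 *m c) ord0 ord0]mxE !mxE.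
Qed.

Lemma scales_mulmx_block n (a : R) (b : 'rV[R]_n) (c : 'cV[R]_n) (M : 'M[R]_n) r
    (h : measurableTypeR R * 'rV[R]_n -> measurableTypeR R * 'rV[R]_n) :
  (forall u, h u = (a * u.1 + (u.2 *m c) ord0 ord0 : measurableTypeR R, u.1 *: b + u.2 *m M)) ->
  scales_measure (lebesgue_measure \x leb n)%E h r ->
  scales_measure (leb n.+1) (fun x => x *m bordered a b c M) r.
Proof.
move=> hE /scales_rV_cons; congr (scales_measure _ _ _).
by apply/funext => x; rewrite /comp hE -[in RHS](rV_unconsK x) mulmx_rV_cons.
Qed.

Lemma scales_mulmx_lower n (a : R) (c : 'cV[R]_n) : a != 0 ->
  scales_measure (leb n.+1)
    (fun x => x *m bordered a 0 c 1%:M) `|a|.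
Proof.
move=> a0; apply: (@scales_mulmx_block _ _ _ _ _ _
    (fun u => (a * u.1 + (u.2 *m c) ord0 ord0 : measurableTypeR R, u.2))).
  by move=> u; rewrite scaler0 add0r mulmx1.
apply: (@scales_product_fst _ _ (leb n) a (fun v => (v *m c) ord0 ord0)) => //.
exact: (measurableT_comp (@measurable_rV_coord R 1 ord0) (measurable_fun_mulmxr c)).
Qed.

Lemma scales_mulmx_diag n (M : 'M[R]_n) r : 0 <= r ->
  scales_measure (leb n) (fun x => x *m M) r ->
  scales_measure (leb n.+1) (fun x => x *m bordered 1 0 0 M) r.
Proof.
move=> r0 Mr.
apply: (@scales_mulmx_block _ _ _ _ _ _ (fun u => (u.1, u.2 *m M))).
  by move=> u; rewrite scaler0 add0r mulmx0 mxE addr0 mul1r.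
apply: (@scales_product_snd _ _ (leb n) (fun _ v => v *m M) r) => //.
by apply: measurableT_comp (measurable_fun_mulmxr M) _; exact: measurable_snd.
Qed.

Lemma scales_mulmx_upper n (b : 'rV[R]_n) :
  scales_measure (leb n.+1)
    (fun x => x *m bordered 1 b 0 1%:M) 1.
Proof.
apply: (@scales_mulmx_block _ _ _ _ _ _ (fun u => (u.1, u.2 + u.1 *: b))).
  by move=> u; rewrite mulmx0 mxE addr0 mul1r mulmx1 addrC.
apply: (@scales_product_snd _ _ (leb n) (fun x v => v + x *: b) 1) => //.
  apply: measurable_funD_rV; first exact: measurable_snd.
  apply: measurable_fun_rV => i.
  rewrite (_ : _ \o _ = fun u : measurableTypeR R * 'rV[R]_n => u.1 * b ord0 i).
    by apply: measurable_funM => //; exact: measurable_fst.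
  by apply/funext => u; rewrite /= /rV_coord mxE.
by move=> x; exact: lebesgue_rV_translate.
Qed.

Lemma scales_mulmxM n (L M : 'M[R]_n) r s :
  scales_measure (leb n) (fun x => x *m L) r ->
  scales_measure (leb n) (fun x => x *m M) s ->
  scales_measure (leb n) (fun x => x *m (L *m M)) (s * r).
Proof.
move=> Lr Ms; have := scales_measure_comp Lr Ms.
by congr (scales_measure _ _ _); apply/funext => x /=; rewrite mulmxA.
Qed.

(** By induction on n: when the corner entry is not zero, block elimination
    writes the matrix as lower shear * block diagonal * upper shear, and each
    factor is handled by Fubini.  A zero corner is made nonzero by adding
    another row to row 0. *)
Lemma lebesgue_rV_mulmx n (L : 'M[R]_n) : \det L != 0 ->
  scales_measure (leb n) (fun x => x *m L) `|\det L|.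
Proof.
elim: n L => [L _|n IH L].
  rewrite det_mx00 normr1 (_ : (fun _ => _) = idfun).
    by split => [|A mA]; [exact: measurable_id|rewrite mul1e preimage_id].
  by apply/funext => x; rewrite !thinmx0.
(* elimination with the Schur complement of the corner *)
have pivot (M : 'M[R]_(1 + n)) : M ord0 ord0 != 0 -> \det M != 0 ->
    scales_measure (leb n.+1) (fun x => x *m M) `|\det M|.
  rewrite -[M]submxK; set b := ursubmx M; set c := dlsubmx M; set M' := drsubmx M.
  rewrite [ulsubmx M]mx11_scalar; set a := ulsubmx M ord0 ord0.
  rewrite -[ord0](_ : lshift n (ord0 : 'I_1) = ord0); last exact/val_inj.
  rewrite (block_mxEul (a%:M) b c M') mxE mulr1n => a0.
  have -> : block_mx a%:M b c M' = block_mx a%:M 0 c 1%:M *m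
      (block_mx 1%:M 0 0 (M' - a^-1 *: (c *m b)) *m block_mx 1%:M (a^-1 *: b) 0 1%:M).
    rewrite !mulmx_block !(mulmx1, mul1mx, mulmx0, mul0mx, addr0, add0r).
    rewrite mul_scalar_mx scalerA divff// scale1r -scalemxAr.
    by rewrite addrC subrK.
  rewrite !det_mulmx !det_lblock !det_ublock !det1 !mulr1 !mul1r det_scalar1.
  rewrite mulf_eq0 negb_or => /andP[_ M0].
  rewrite normrM mulrC; apply: scales_mulmxM; first exact: scales_mulmx_lower.
  rewrite -[X in scales_measure _ _ X]mul1r; apply: scales_mulmxM.
    by apply: scales_mulmx_diag => //; exact: IH.
  exact: scales_mulmx_upper.
move=> L0; have [L00|L00] := eqVneq (L ord0 ord0) 0; last exact: pivot.
have [j Lj] : exists j, L (lift ord0 j) ord0 != 0.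
  apply: contrapT => /forallNP Lj; case/eqP: L0.
  rewrite (expand_det_col _ ord0) big1// => i _.
  have [j ->|->] := unliftP ord0 i; last by rewrite L00 mul0r.
  by have /negP := Lj j; rewrite negbK => /eqP ->; rewrite mul0r.
pose E (s : R) : 'M[R]_(1 + n) := block_mx 1%:M (s *: delta_mx ord0 j) 0 1%:M.
have -> : L = E (-1) *m (E 1 *m L).
  rewrite mulmxA /E mulmx_block !(mulmx1, mul1mx, mulmx0, mul0mx, addr0, add0r).
  by rewrite -scalerDl subrr scale0r -scalar_mx_block mul1mx.
have dE s : \det (E s) = 1 by rewrite det_ublock !det1 mulr1.
rewrite !det_mulmx !dE !mul1r -[X in scales_measure _ _ X]mulr1.
apply: scales_mulmxM; first exact: scales_mulmx_upper.
have -> : \det L = \det (E 1 *m L) by rewrite det_mulmx dE mul1r.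
apply: pivot; last first.
  by rewrite det_mulmx dE mul1r.
have E0 i : E 1 ord0 (lift ord0 i) = (i == j)%:R.
  have -> : lift ord0 i = rshift 1 i by exact/val_inj.
  rewrite -[ord0](_ : lshift n (ord0 : 'I_1) = ord0); last exact/val_inj.
  by rewrite block_mxEur scale1r mxE eqxx.
rewrite mxE (bigD1 ord0)//= (bigD1 (lift ord0 j))//= L00 mulr0 add0r.
rewrite E0 eqxx mul1r big1 ?addr0// => i /andP[i0].
have [k ->|ik] := unliftP ord0 i; last by rewrite ik eqxx in i0.
by rewrite E0 (inj_eq (@lift_inj _ ord0)) => /negPf ->; rewrite mul0r.
Qed.
End linear_change.

(** * Cubes and Borel sets *)

Section rV_topology.
Context {R : realType} {n : nat}.
Implicit Types (x b : 'rV[R]_n) (r : R).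

Lemma rV_norm_leP x r : 0 <= r ->
  (`|x| <= r) <-> (forall i, `|x ord0 i| <= r).
Proof.
move=> r0; rewrite {1}/Num.norm /= mx_normrE; split=> [/bigmax_leP[_ h] i|h].
  exact: (h (ord0, i)).
by apply/bigmax_leP; split => // -[i j] _ /=; rewrite ord1.
Qed.

Lemma rV_norm_ltP x r : 0 < r ->
  (`|x| < r) <-> (forall i, `|x ord0 i| < r).
Proof.
move=> r0; rewrite {1}/Num.norm /= mx_normrE; split=> [/bigmax_ltP[_ h] i|h].
  exact: (h (ord0, i)).
by apply/bigmax_ltP; split => // -[i j] _ /=; rewrite ord1.
Qed.

Lemma rV_coord_norm x i : `|x ord0 i| <= `|x|.
Proof. by have [+ _] := rV_norm_leP x (normr_ge0 x); apply. Qed.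

(** Balls of the norm of row vectors, which is the sup norm: cubes of side
    2 r, closed and open. *)
Definition ccube b r : set 'rV[R]_n := [set x | `|x - b| <= r].
Definition ocube b r : set 'rV[R]_n := [set x | `|x - b| < r].

Lemma ocube_ball b r : ocube b r = ball b r.
Proof.
by apply/seteqP; split => x; rewrite -ball_normE /ball_ /ocube /= distrC.
Qed.

Lemma ocube_open b r : open (ocube b r).
Proof. by rewrite ocube_ball; exact: ball_open. Qed.

Lemma ocubeW b r : ocube b r `<=` ccube b r.
Proof. by move=> x; rewrite /ocube /ccube /= => /ltW. Qed.

Lemma ccube_closed b r : closed (ccube b r).
Proof.
move=> x cx; rewrite /ccube /= leNgt; apply/negP => rx.
have d0 : 0 < `|x - b| - r by rewrite subr_gt0.
have [|y [yb xy]] := cx (ocube x (`|x - b| - r)).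
  by rewrite ocube_ball; exact: nbhsx_ballx.
have : `|x - b| <= `|x - y| + `|y - b| by exact: ler_distD.
by move: yb xy; rewrite /ccube /ocube /= [`|y - x|]distrC; lra.
Qed.

Lemma ccube_compact b r : compact (ccube b r).
Proof.
apply: bounded_closed_compact; last exact: ccube_closed.
exists (`|b| + r); split=> [|M Mb x]; first exact: num_real.
rewrite /ccube /= => xr; apply: le_trans (ltW Mb).
by rewrite -[x](subrK b) addrC (le_trans (ler_normD _ _))// lerD.
Qed.

Lemma ocube_center b r : 0 < r -> ocube b r b.
Proof. by move=> r0; rewrite /ocube /= subrr normr0. Qed.

Lemma ocube_line b v r : 0 < r ->
  exists2 r', 0 < r' & forall t, `|t| <= r' -> ocube b r (b + t *: v).
Proof.
move=> r0; have v0 : 0 < `|v| + 1 by rewrite ltr_wpDl.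
exists (r / (`|v| + 1) / 2) => [|t tr]; first by rewrite !divr_gt0.
rewrite /ocube /= addrC addKr normrZ.
apply: (@le_lt_trans _ _ (`|t| * (`|v| + 1))); first by rewrite ler_wpM2l// lerDl.
rewrite -ltr_pdivlMr//; apply: le_lt_trans tr _.
by rewrite ltr_pdivrMr// ltr_pMr ?ltr1n// divr_gt0.
Qed.

Lemma ccubeE b r : 0 <= r ->
  ccube b r = [set x | forall i, `[b ord0 i - r, b ord0 i + r]%classic (x ord0 i)].
Proof.
move=> r0; apply/seteqP; split => x; rewrite /ccube /=.
  by move=> /(rV_norm_leP _ r0) h i; have := h i; rewrite !mxE ler_distl in_itv.
by move=> h; apply/(rV_norm_leP _ r0) => i; have := h i; rewrite !mxE ler_distl in_itv.
Qed.

Lemma ocubeE b r : 0 < r ->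
  ocube b r = [set x | forall i, `]b ord0 i - r, b ord0 i + r[%classic (x ord0 i)].
Proof.
move=> r0; apply/seteqP; split => x; rewrite /ocube /=.
  by move=> /(rV_norm_ltP _ r0) h i; have := h i; rewrite !mxE ltr_distl in_itv.
by move=> h; apply/(rV_norm_ltP _ r0) => i; have := h i; rewrite !mxE ltr_distl in_itv.
Qed.

Lemma measurable_rV_box (A : 'I_n -> set (measurableTypeR R)) :
  (forall i, measurable (A i)) ->
  measurable [set x : 'rV[R]_n | forall i, A i (x ord0 i)].
Proof.
move=> mA; rewrite (_ : [set _ | _] =
    \bigcap_(i in [set: 'I_n]) (rV_coord i @^-1` A i)).
  apply: fin_bigcap_measurable => // i _.
  exact: measurable_preimageT (@measurable_rV_coord R n i) (mA i).
by apply/seteqP; split => x /= h i; [move=> _|]; exact: h.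
Qed.

Lemma ccube_measurable b r : measurable (ccube b r).
Proof.
have [r0|r0] := leP 0 r; first by rewrite ccubeE//;
  apply: (measurable_rV_box (A := fun i => `[b ord0 i - r, b ord0 i + r]%classic)).
rewrite (_ : ccube b r = set0)//; apply/seteqP; split => x //.
by rewrite /ccube /= => /(le_trans (normr_ge0 _)); rewrite leNgt r0.
Qed.

Lemma ocube_measurable b r : measurable (ocube b r).
Proof.
have [r0|r0] := ltP 0 r; first by rewrite ocubeE//;
  apply: (measurable_rV_box (A := fun i => `]b ord0 i - r, b ord0 i + r[%classic)).
rewrite (_ : ocube b r = set0)//; apply/seteqP; split => x //.
by rewrite /ocube /= => /(le_lt_trans (normr_ge0 _)); rewrite ltNge r0.
Qed.

Lemma lebesgue_ccube b r : 0 <= r ->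
  lebesgue_rV n (ccube b r) = ((r *+ 2) ^+ n)%:E.
Proof.
move=> r0; rewrite ccubeE// (@lebesgue_rV_box _ _
  (fun i => `[b ord0 i - r, b ord0 i + r]%classic))//.
rewrite (eq_bigr (fun=> (r *+ 2)%:E)) => [|i _].
  by rewrite prodEFin prodr_const card_ord.
rewrite lebesgue_measure_itv/= lte_fin.
case: ltP => h; first by rewrite -EFinD; congr EFin; rewrite mulr2n; lra.
by congr EFin; move: h; rewrite mulr2n; lra.
Qed.

Lemma lebesgue_ocube b r : 0 < r ->
  lebesgue_rV n (ocube b r) = ((r *+ 2) ^+ n)%:E.
Proof.
move=> r0; rewrite ocubeE// (@lebesgue_rV_box _ _
  (fun i => `]b ord0 i - r, b ord0 i + r[%classic))//.
rewrite (eq_bigr (fun=> (r *+ 2)%:E)) => [|i _].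
  by rewrite prodEFin prodr_const card_ord.
rewrite lebesgue_measure_itv/= lte_fin.
case: ltP => h; first by rewrite -EFinD; congr EFin; rewrite mulr2n; lra.
by congr EFin; move: h; rewrite mulr2n; lra.
Qed.

(** An open set is the countable union of the cubes with rational center and
    side 2/(k+1) that it contains. *)
Lemma open_measurable_rV (U : set 'rV[R]_n) : open U -> measurable U.
Proof.
move=> oU.
pose F (zk : 'rV[rat]_n * nat) : set 'rV[R]_n :=
  let B := ocube (map_mx ratr zk.1) zk.2.+1%:R^-1 in
  if `[< B `<=` U >] then B else set0.
have -> : U = \bigcup_zk F zk.
  apply/seteqP; split => [x Ux|x [zk _]]; last first.
    by rewrite /F; case: asboolP => // BU; exact: BU.
  have /nbhs_ballP[e /= e0 eU] := open_nbhs_nbhs (conj oU Ux : open_nbhs x U).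
  have e20 : 0 < e / 2 by rewrite divr_gt0.
  have [k ke] : exists k, k.+1%:R^-1 < e / 2.
    by have [k] := ltr_add_invr e20; rewrite add0r; exists k.
  have d0 : 0 < k.+1%:R^-1 :> R by rewrite invr_gt0.
  have zP i : exists z : rat, `|x ord0 i - ratr z| < k.+1%:R^-1.
    have [|z] := @rat_in_itvoo R (x ord0 i - k.+1%:R^-1) (x ord0 i + k.+1%:R^-1).
      by rewrite ltrBlDr -addrA ltrDl addr_gt0.
    by rewrite in_itv/= => h; exists z; rewrite distrC ltr_distl.
  pose z := \row_i projT1 (cid (zP i)).
  exists (z, k) => //.
  have xz : ocube (map_mx ratr z) k.+1%:R^-1 x.
    by apply/rV_norm_ltP => // i; rewrite !mxE; case: cid.
  rewrite /F /=; case: asboolP => // -[] y yz; apply: eU.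
  rewrite -ocube_ball /ocube /= in xz yz *.
  rewrite (le_lt_trans (ler_distD (map_mx ratr z) _ _))// [ltRHS]splitr.
  by apply: ltrD; [exact: lt_trans ke|rewrite distrC; exact: lt_trans ke].
apply: countable_bigcupT_measurable => // zk.
by rewrite /F; case: ifP => // _; exact: ocube_measurable.
Qed.

Lemma closed_measurable_rV (U : set 'rV[R]_n) : closed U -> measurable U.
Proof.
move=> cU; rewrite -(setCK U); apply: measurableC; apply: open_measurable_rV.
exact: closed_openC.
 Qed.

Lemma measurable_fun_lsc (U : set 'rV[R]_n) (g : 'rV[R]_n -> R) :
  (forall a, open (U `&` [set x | a < g x])) -> measurable_fun U g.
Proof.
move=> gU; apply: (measurability _ (RGenOInfty.measurableE R)).
move=> _ [_ [a ->] <-].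
rewrite (_ : _ `&` _ = U `&` [set x | a < g x]); first exact: open_measurable_rV.
by apply/seteqP; split=> x [Ux] /=; rewrite in_itv/= andbT.
Qed.

Lemma open_continuous_measurable_rV (U : set 'rV[R]_n) (g : 'rV[R]_n -> R) :
  open U -> (forall x, U x -> {for x, continuous g}) -> measurable_fun U g.
Proof.
move=> oU cg; apply: measurable_fun_lsc => a; rewrite openE => x [Ux ax].
apply: filterI; first exact: open_nbhs_nbhs.
have /(_ [set t | a < t]) := cg x Ux; apply.
by apply: open_nbhs_nbhs; split => //; exact: open_gt.
Qed.

End rV_topology.

(** * Strict differentiability of C^1 functions *)

Section strict_differentiability.
Context {R : realType} {n : nat}.
Implicit Types (U : set 'rV[R]_n) (c x e : 'rV[R]_n).

Lemma line_derivative (g : 'rV[R]_n -> R) x e (s : R) :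
  derivable g (x + s *: e) e ->
  is_derive s 1 (fun s => g (x + s *: e)) ('D_e g (x + s *: e)).
Proof.
move=> dg; have E : (fun h : R => h^-1 *:
    (((fun s => g (x + s *: e)) \o shift s) (h *: 1) - g (x + s *: e))) =
    (fun h : R => h^-1 *: ((g \o shift (x + s *: e)) (h *: e) - g (x + s *: e))).
  apply/funext => h /=; congr (_ *: (g _ - _)).
  by rewrite [h *: 1]mulr1 scalerDl addrCA.
by split; rewrite ?/derivable ?/derive E.
Qed.

Lemma line_mean_value (g : 'rV[R]_n -> R) x e (a b w d : R) : a <= b ->
  (forall s, a <= s <= b -> derivable g (x + s *: e) e) ->
  (forall s, a <= s <= b -> `|'D_e g (x + s *: e) - w| <= d) ->
  `|g (x + b *: e) - g (x + a *: e) - (b - a) * w| <= d * (b - a).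
Proof.
move=> ab dg gw.
have [s sab||s sab ->] := @MVT_segment R (fun s => g (x + s *: e))
    (fun s => 'D_e g (x + s *: e)) a b ab.
- apply: line_derivative; apply: dg; move: sab; rewrite in_itv/= => /andP[? ?].
  by rewrite !ltW.
- apply: derivable_within_continuous => s; rewrite in_itv/= => sab.
  by apply: ex_derive; apply: line_derivative; exact: dg.
- rewrite [(b - a) * w]mulrC -mulrBl normrM (ger0_norm (_ : 0 <= b - a)) ?subr_ge0//.
  by apply: ler_wpM2r; rewrite ?subr_ge0//; apply: gw; rewrite in_itv in sab.
Qed.

(** [line_mean_value] with the sign of the increment removed. *)
Lemma axis_mean_value (g : 'rV[R]_n -> R) x e (h w d : R) :
  (forall s, 0 <= s <= 1 -> derivable g (x + (s * h) *: e) e) ->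
  (forall s, 0 <= s <= 1 -> `|'D_e g (x + (s * h) *: e) - w| <= d) ->
  `|g (x + h *: e) - g x - h * w| <= d * `|h|.
Proof.
have [h0|h0] := leP 0 h => dg gw.
  have seg s : 0 <= s <= h -> exists2 t, 0 <= t <= 1 & s = t * h.
    move=> /andP[s0 sh]; have [hE|hN] := eqVneq h 0.
      by exists 0; rewrite ?lexx ?ler01// mul0r; apply/eqP; rewrite eq_le s0 -hE sh.
    by exists (s / h); rewrite ?divfK// divr_ge0//= ler_pdivrMr ?mul1r// lt_neqAle eq_sym hN.
  have := @line_mean_value g x e 0 h w d h0.
  rewrite scale0r addr0 subr0 (ger0_norm h0); apply => s /seg[t t01 ->].
    exact: dg.
  exact: gw.
have seg s : h <= s <= 0 -> exists2 t, 0 <= t <= 1 & s = t * h.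
  move=> /andP[hs s0]; exists (s / h); last by rewrite divfK// lt_eqF.
  by rewrite mulr_le0 ?invr_le0 ?(ltW h0)//= ler_ndivrMr// mul1r.
have := @line_mean_value g x e h 0 w d (ltW h0).
rewrite scale0r addr0 sub0r (ltr0_norm h0) -normrN.
rewrite (_ : - (_ - _ - _) = g (x + h *: e) - g x - h * w); last by ring.
by apply => s /seg[t t01 ->]; [exact: dg|exact: gw].
Qed.

(** Differentiability at c with both end points free near c; w is the
    gradient. *)
Definition strict_gradient (g : 'rV[R]_n -> R) c (w : 'I_n -> R) :=
  forall d, 0 < d -> exists2 r, 0 < r & forall u v, ocube c r u -> ocube c r v ->
    `|g u - g v - \sum_i (u - v) ord0 i * w i| <= d * `|u - v|.

(** Go from v to u by changing one coordinate at a time; the path stays in the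
    cube, and the mean value theorem applies on each of its n segments. *)
Lemma C1on_strict_gradient U (g : 'rV[R]_n -> R) c : open U -> U c ->
  C1on U g -> strict_gradient g c (fun i => partial i g c).
Proof.
move=> oU Uc C1 d d0.
(* n segments, each allowed an error d' *)
pose d' := d / n.+1%:R; have d'0 : 0 < d' by rewrite divr_gt0.
have : \forall x \near c, U x /\ forall i, `|partial i g c - partial i g x| < d'.
  apply: filterI; first exact: open_nbhs_nbhs.
  apply: (@filter_forall _ _ (fun i x => `|partial i g c - partial i g x| < d') (nbhs c) _) => i.
  by have /cvgrPdist_lt/(_ _ d'0) := (C1 i).2 c Uc.
move=> /nbhs_ballP[r /= r0]; rewrite -ocube_ball => near_c.
exists r => // u v uc vc.
pose w k : 'rV[R]_n := \row_i (if (i < k)%N then u ord0 i else v ord0 i).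
have w0 : w 0%N = v by apply/rowP => i; rewrite mxE.
have wn : w n = u by apply/rowP => i; rewrite mxE ltn_ord.
have wS (k : 'I_n) s : w k + s *: delta_mx ord0 k = \row_i
    (if (i < k)%N then u ord0 i else if i == k then v ord0 i + s else v ord0 i).
  apply/rowP => i; rewrite !mxE eqxx /=; have [->|ik] := eqVneq i k.
    by rewrite ltnn mulr1.
  by rewrite mulr0 addr0.
have wSk (k : 'I_n) : w k.+1 = w k + (u - v) ord0 k *: delta_mx ord0 k.
  rewrite wS; apply/rowP => i; rewrite !mxE ltnS leq_eqVlt (inj_eq val_inj).
  by have [->|] := eqVneq i k; rewrite ?ltnn //= [RHS]addrC subrK.
have uci i := (rV_norm_ltP (u - c) r0).1 uc i.
have vci i := (rV_norm_ltP (v - c) r0).1 vc i.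
have wcube (k : 'I_n) s : 0 <= s <= 1 ->
    ocube c r (w k + (s * (u - v) ord0 k) *: delta_mx ord0 k).
  move=> /andP[s0 s1]; rewrite wS; apply/rV_norm_ltP => // i.
  move: (uci i) (vci i); rewrite !mxE.
  case: ifP => // _; case: eqP => [->|//].
  rewrite !ltr_norml; set a := u ord0 k; set b := v ord0 k; set e := c ord0 k.
  move=> /andP[a1 a2] /andP[b1 b2]; have [->|s1'] := eqVneq s 1.
    by rewrite mul1r [b + _]addrC subrK a1 a2.
  have {s1'}s1 : 0 < 1 - s by rewrite subr_gt0 lt_neqAle s1'.
  rewrite -ltr_norml (_ : _ - _ = (1 - s) * (b - e) + s * (a - e)); last by ring.
  have := mulr_gt0 s1 (_ : 0 < b - e + r); have := mulr_gt0 s1 (_ : 0 < r - (b - e)).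
  have := mulr_ge0 s0 (_ : 0 <= a - e + r); have := mulr_ge0 s0 (_ : 0 <= r - (a - e)).
  move=> /(_ ltac:(lra)) h1 /(_ ltac:(lra)) h2 /(_ ltac:(lra)) h3 /(_ ltac:(lra)) h4.
  by rewrite ltr_norml; apply/andP; split; lra.
have -> : g u - g v = \sum_(k < n) (g (w k.+1) - g (w k)).
  rewrite -(big_mkord xpredT (fun k => g (w k.+1) - g (w k))).
  by rewrite (telescope_sumr (g \o w))//= w0 wn.
rewrite -sumrB; apply: le_trans (ler_norm_sum _ _ _) _.
have step (k : 'I_n) : `|g (w k.+1) - g (w k) - (u - v) ord0 k * partial k g c|
    <= d' * `|u - v|.
  rewrite wSk; apply: (@le_trans _ _ (d' * `|(u - v) ord0 k|)); last first.
    by apply: ler_wpM2l; [exact: ltW|exact: rV_coord_norm].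
  apply: axis_mean_value => s s01.
    by apply: (C1 k).1; exact: (near_c _ (wcube _ _ s01)).1.
  rewrite distrC; apply/ltW.
  exact: (near_c _ (wcube _ _ s01)).2.
apply: le_trans (ler_sum _ (fun k _ => step k)) _.
rewrite sumr_const card_ord -mulr_natl mulrA ler_wpM2r//.
rewrite /d' mulrCA ler_piMr ?(ltW d0)// ler_pdivrMr// mul1r ler_nat.
exact: leqnSn.
Qed.
End strict_differentiability.

(** * Images of small cubes under almost linear maps *)

HB.instance Definition _ (R : realType) m n := Complete.on 'M[R]_(m, n).

Section local_volume.
Context {R : realType} {n : nat}.
Implicit Types (c b t v : 'rV[R]_n) (L M : 'M[R]_n) (T : 'rV[R]_n -> 'rV[R]_n).
Notation leb := (lebesgue_rV n).

Definition strict_diff T c L :=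
  forall d, 0 < d -> exists2 r, 0 < r & forall u v, ocube c r u -> ocube c r v ->
    `|T u - T v - (u - v) *m L| <= d * `|u - v|.

(** A crude bound for the operator norm. *)
Definition mx_bound L : R := \sum_i \sum_j `|L i j|.

Lemma mx_bound_ge0 L : 0 <= mx_bound L.
Proof. by apply: sumr_ge0 => i _; exact: sumr_ge0. Qed.

Lemma mulmx_bound v L : `|v *m L| <= mx_bound L * `|v|.
Proof.
apply/rV_norm_leP => [|j]; first by rewrite mulr_ge0// mx_bound_ge0.
rewrite mxE mulr_suml; apply: le_trans (ler_norm_sum _ _ _) _.
apply: ler_sum => i _; rewrite normrM mulrC ler_pM ?rV_coord_norm//.
by rewrite (bigD1 j)//= lerDl sumr_ge0.
Qed.

Lemma lebesgue_affine_preimage t M (B : set 'rV[R]_n) :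
  \det M != 0 -> measurable B ->
  measurable ((fun y => (y - t) *m M) @^-1` B) /\
  (`|\det M|%:E * leb ((fun y => (y - t) *m M) @^-1` B) = leb B)%E.
Proof.
move=> M0 mB; have [mphi phiE] :=
  scales_measure_comp (lebesgue_rV_translate (- t)) (lebesgue_rV_mulmx M0).
split; first exact: (measurable_preimageT mphi).
by rewrite -[RHS](phiE B mB) mulr1.
Qed.

Lemma poly_near0 (p : {poly R}) (e : R) : 0 < e ->
  exists2 d, 0 < d & forall x, 0 <= x <= d -> `|p.[x] - p.[0]| <= e.
Proof.
move=> e0; have /cvgrPdist_le/(_ _ e0)/nbhs_ballP[d /= d0 h] := @continuous_horner R p 0.
exists (d / 2); first by rewrite divr_gt0.
move=> x /andP[x0 xd]; rewrite distrC; apply: h.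
rewrite /ball /= sub0r normrN ger0_norm//; apply: le_lt_trans xd _; lra.
Qed.

Lemma exp_near1 (a K e : R) : 0 < e -> exists2 d, 0 < d & forall x, 0 <= x <= d ->
  `|a * (1 + K * x) ^+ n - a| <= e.
Proof.
move=> e0; have [d d0 h] := poly_near0 (a%:P * (1 + K *: 'X) ^+ n) e0.
exists d => // x /h; rewrite !hornerE /=.
by rewrite expr1n mulr1.
Qed.

(** After composition with the inverse of L, the map is close to the
    identity. *)
Lemma strict_diff_affine T c L (d r : R) b : L \in unitmx ->
  (forall u v, ocube c r u -> ocube c r v ->
    `|T u - T v - (u - v) *m L| <= d * `|u - v|) -> ocube c r b ->
  forall u v, ocube c r u -> ocube c r v ->
    `|(T u - T v) *m invmx L - (u - v)| <= mx_bound (invmx L) * d * `|u - v|.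
Proof.
move=> uL h cb u v cu cv.
rewrite -[X in _ - X](mulmxK uL) -mulmxBl -mulrA (le_trans (mulmx_bound _ _))//.
by rewrite ler_wpM2l ?mx_bound_ge0// h.
Qed.

Lemma lebesgue_parallelepiped L t (B : set 'rV[R]_n) (a : R) : \det L != 0 -> measurable B ->
  leb B = a%:E ->
  measurable ((fun y => (y - t) *m invmx L) @^-1` B) /\
  leb ((fun y => (y - t) *m invmx L) @^-1` B) = (`|\det L| * a)%:E.
Proof.
move=> L0 mB Ba; have uL : L \in unitmx by rewrite unitmxE unitfE.
have Li0 : \det (invmx L) != 0 by rewrite det_inv invr_eq0.
have [mP PE] := lebesgue_affine_preimage t Li0 mB; split=> //.
rewrite EFinM -Ba -PE muleA -EFinM det_inv normfV divff ?mul1e//.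
by rewrite normr_eq0.
Qed.

(** The image lies in the image under L of a cube enlarged by the factor
    1 + K d, where K bounds the inverse of L. *)
Lemma local_volume_upper_regular T c L (e : R) : strict_diff T c L -> \det L != 0 ->
  0 < e -> exists2 r, 0 < r & forall b s, 0 < s -> ccube b s `<=` ocube c r ->
  exists B, [/\ measurable B, T @` ccube b s `<=` B &
    (leb B <= ((`|\det L| + e) * (s *+ 2) ^+ n)%:E)%E].
Proof.
move=> TL L0 e0; have uL : L \in unitmx by rewrite unitmxE unitfE.
pose K := mx_bound (invmx L); have K0 : 0 <= K := mx_bound_ge0 _.
have [d d0 dP] := exp_near1 `|\det L| K e0.
have [r r0 rP] := TL d d0; exists r => // b s s0 sub.
have cb : ocube c r b by apply: sub; rewrite /ccube /= subrr normr0 ltW.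
have s1 : 0 <= (1 + K * d) * s by rewrite mulr_ge0 ?(ltW s0)// addr_ge0// mulr_ge0// ltW.
have [mB BE] := lebesgue_parallelepiped (T b) L0 (ccube_measurable 0 _) (lebesgue_ccube 0 s1).
eexists; split; [exact: mB| |rewrite BE lee_fin].
  move=> _ [u bu <-] /=; rewrite /ccube /= subr0.
  have /= := strict_diff_affine uL rP cb (sub _ bu) cb.
  rewrite -/K => h; rewrite -[X in `|X|](subrK (u - b)) (le_trans (ler_normD _ _))//.
  rewrite mulrDl mul1r addrC; apply: lerD => //; apply: (le_trans h).
  by rewrite ler_wpM2l// mulr_ge0// ltW.
rewrite -mulrnAr exprMn mulrA ler_wpM2r ?exprn_ge0 ?mulrn_wge0 ?(ltW s0)//.
have := dP d; rewrite lexx (ltW d0) => /(_ isT).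
by move=> /(le_trans (ler_norm _)); rewrite lerBlDl.
Qed.

Lemma fixed_point_ccube (f : 'rV[R]_n -> 'rV[R]_n) b s q : 0 <= s -> 0 <= q < 1 ->
  (forall u, ccube b s u -> ccube b s (f u)) ->
  (forall u v, ccube b s u -> ccube b s v -> `|f u - f v| <= q * `|u - v|) ->
  exists2 p, ccube b s p & p = f p.
Proof.
move=> s0 /andP[q0 q1] fU flip.
pose g := [fun of mkfun (fU : {homo f : x / ccube b s x})].
apply: (@banach_fixed_point R _ _ g).
- exists (NngNum q0); split => // -[u v] [/= Uu Uv]; exact: flip.
- exact: ccube_closed.
- by exists b; rewrite /ccube /= subrr normr0.
Qed.

Lemma open_affine_preimage_ocube t M r :
  open ((fun y => (y - t) *m M) @^-1` ocube 0 r).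
Proof.
rewrite openE => y /=; rewrite /ocube /= subr0 => yr.
have K0 : 0 < mx_bound M + 1 by rewrite ltr_wpDl// mx_bound_ge0.
apply/nbhs_ballP; exists ((r - `|(y - t) *m M|) / (mx_bound M + 1)).
  by rewrite /= divr_gt0// subr_gt0.
move=> z; rewrite -ocube_ball /ocube /= subr0 ltr_pdivlMr// => zy.
rewrite -(subrK y z) -addrA mulmxDl (le_lt_trans (ler_normD _ _))// -ltrBrDr.
apply: le_lt_trans zy; apply: le_trans (mulmx_bound _ _) _.
by rewrite mulrC ler_wpM2l// lerDl.
Qed.

(** A solution of T u = y is a fixed point of u - (T u - y) L^-1, a contraction
    of the closed cube of half-side z about b.  Any z with
    |(y - T b) L^-1| <= (1 - q) z makes this cube invariant, and the smallest
    such z is less than s. *)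
Lemma local_surjectivity T c L d r b s y : L \in unitmx ->
  (forall u v, ocube c r u -> ocube c r v ->
    `|T u - T v - (u - v) *m L| <= d * `|u - v|) ->
  0 <= d -> mx_bound (invmx L) * d < 1 -> 0 < s -> ccube b s `<=` ocube c r ->
  ocube 0 ((1 - mx_bound (invmx L) * d) * s) ((y - T b) *m invmx L) ->
  (T @` ocube b s) y.
Proof.
move=> uL TL d0; set q := _ * d => q1 s0 sub.
have q0 : 0 <= q by rewrite mulr_ge0 ?mx_bound_ge0.
rewrite /ocube /= subr0; set w := _ *m _ => ws.
have cb : ocube c r b by apply: sub; rewrite /ccube /= subrr normr0 ltW.
have q1' : 0 < 1 - q by rewrite subr_gt0.
pose z := `|w| / (1 - q).
have z0 : 0 <= z by rewrite divr_ge0// ltW.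
have zs : z < s by rewrite ltr_pdivrMr// mulrC.
have zc u : ccube b z u -> ocube c r u.
  by move=> bu; apply: sub; apply: le_trans (ltW zs).
have sda := strict_diff_affine uL TL cb.
pose f u := u - (T u - y) *m invmx L.
have fE u v : f u - f v = - ((T u - T v) *m invmx L - (u - v)).
  by rewrite /f !mulmxBl; apply/rowP => i; rewrite !mxE; ring.
have [|||p bp pE] := @fixed_point_ccube f b z q z0.
- by rewrite q0.
- move=> u bu; rewrite /ccube /=.
  have -> : f u - b = f u - f b + w by rewrite /w /f !mulmxBl; apply/rowP => i; rewrite !mxE; ring.
  rewrite fE (le_trans (ler_normD _ _))// normrN.
  have -> : z = q * z + `|w| by rewrite /z; field; rewrite gt_eqF.
  apply: lerD => //; apply: le_trans (sda _ _ (zc _ bu) cb) _.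
  exact: ler_wpM2l.
- by move=> u v bu bv; rewrite fE normrN; apply: sda; exact: zc.
exists p; first exact: le_lt_trans zs.
have /(congr1 (fun x => (p - x) *m L)) := pE.
rewrite subrr mul0mx /f opprB addrCA subrr addr0 -mulmxA mulVmx// mulmx1.
by move/eqP; rewrite eq_sym subr_eq0 => /eqP.
Qed.

Lemma local_volume_lower T c L (e : R) : strict_diff T c L -> \det L != 0 ->
  0 < e -> exists2 r, 0 < r & forall b s, 0 < s -> ccube b s `<=` ocube c r ->
  exists B, [/\ open B, B (T b), B `<=` T @` ocube b s &
    (((`|\det L| - e) * (s *+ 2) ^+ n)%:E <= leb B)%E].
Proof.
move=> TL L0 e0; have uL : L \in unitmx by rewrite unitmxE unitfE.
pose K := mx_bound (invmx L); have K0 : 0 <= K := mx_bound_ge0 _.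
have [d1 d10 dP] := exp_near1 `|\det L| (- K) e0.
pose d := Num.min d1 (K + 1)^-1.
have d0 : 0 < d by rewrite lt_min d10 invr_gt0 ltr_wpDl.
have Kd : K * d < 1.
  apply: (@le_lt_trans _ _ (K * (K + 1)^-1)); first by rewrite ler_wpM2l// ge_min lexx orbT.
  by rewrite ltr_pdivrMr ?ltr_wpDl// mul1r ltrDl.
have [r r0 rP] := TL d d0; exists r => // b s s0 sub.
have s1 : 0 < (1 - K * d) * s by rewrite mulr_gt0// subr_gt0.
have [mB BE] := lebesgue_parallelepiped (T b) L0 (ocube_measurable 0 _) (lebesgue_ocube 0 s1).
exists ((fun y => (y - T b) *m invmx L) @^-1` ocube 0 ((1 - K * d) * s)); split.
- exact: open_affine_preimage_ocube.
- by rewrite /= subrr mul0mx /ocube /= subrr normr0; exact: s1.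
- by move=> y; apply: local_surjectivity rP _ Kd s0 sub => //; exact: ltW.
rewrite BE lee_fin -mulrnAr exprMn mulrA ler_wpM2r ?exprn_ge0 ?mulrn_wge0 ?(ltW s0)//.
have := dP d; rewrite (ltW d0) ge_min lexx => /(_ isT).
by rewrite ler_norml mulNr lerBrDl => /andP[].
Qed.

(** The identity with one column replaced by w: it exhibits the functional w as
    a coordinate of a volume preserving change of coordinates. *)
Lemma slab_matrix (w : 'cV[R]_n) i0 : w i0 ord0 = 1 ->
  exists M : 'M[R]_n, \det M = 1 /\
   forall v j, (v *m M) ord0 j = if j == i0 then (v *m w) ord0 ord0 else v ord0 j.
Proof.
move=> w1; pose M : 'M[R]_n := \matrix_(i, j) if j == i0 then w i ord0 else (i == j)%:R.
(* these cofactors ignore column i0, so they are those of the identity *)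
have cof i : cofactor M i i0 = (i == i0)%:R.
  have -> : cofactor M i i0 = cofactor 1%:M i i0.
    rewrite /cofactor; congr (_ * \det _); apply/matrixP => k l; rewrite !mxE.
    by rewrite eq_sym (negPf (neq_lift _ _)).
  have := mul_mx_adj (1%:M : 'M[R]_n); rewrite mul1mx det1 => /matrixP/(_ i0 i).
  by rewrite !mxE eq_sym.
exists M; split; last first.
  move=> v j; rewrite !mxE; case: eqVneq => [->|ji].
    by apply: eq_bigr => i _; rewrite mxE eqxx.
  rewrite (bigD1 j)//= mxE (negPf ji) eqxx mulr1 big1 ?addr0// => i ij.
  by rewrite mxE (negPf ji) (negPf ij) mulr0.
rewrite (expand_det_col _ i0) (bigD1 i0)//= big1 => [|i ii0].
  by rewrite !mxE eqxx w1 mul1r cof eqxx addr0.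
by rewrite cof (negPf ii0) mulr0.
Qed.

(** A vector w with L w = 0 shows that the image is thin in the direction w:
    the linear part contributes nothing to <., w>, and only the error, of
    relative size d, remains.  The image thus lies in a slab of volume
    C^(n-1) n d times that of the cube.  Normalizing w to have largest entry 1
    keeps the constants independent of w. *)
Lemma local_volume_upper_singular T c L (e : R) : strict_diff T c L -> \det L = 0 ->
  0 < e -> exists2 r, 0 < r & forall b s, 0 < s -> ccube b s `<=` ocube c r ->
  exists B, [/\ measurable B, T @` ccube b s `<=` B &
    (leb B <= (e * (s *+ 2) ^+ n)%:E)%E].
Proof.
move=> TL L0 e0.
have [w [i0 [w1 wi Lw]]] : exists w : 'cV[R]_n, exists i0, [/\ w i0 ord0 = 1,
    forall i, `|w i ord0| <= 1 & L *m w = 0].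
  have /det0P[x x0 xL] : \det L^T == 0 by rewrite det_tr L0.
  have [[i i0]/=] : exists i, mx_norm x = `|x i.1 i.2|.
    by apply: mx_norm_neq0; apply: contra_neq x0 => /mx_norm_eq0.
  rewrite ord1 => xE.
  have xi0 : x ord0 i0 != 0.
    by rewrite -normr_eq0 -xE; apply: contra_neq x0 => /mx_norm_eq0.
  exists ((x ord0 i0)^-1 *: x^T), i0; split.
  - by rewrite !mxE mulVf.
  - move=> j; rewrite !mxE normrM normfV mulrC ler_pdivrMr ?normr_gt0// mul1r -xE.
    exact: rV_coord_norm.
  - by rewrite -scalemxAr -[L]trmxK -trmx_mul xL trmx0 scaler0.
have [M [M1 ME]] := slab_matrix w1.
have M0 : \det M != 0 by rewrite M1 oner_neq0.
pose C := mx_bound L + 1; have C0 : 0 < C by rewrite ltr_wpDl// mx_bound_ge0.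
(* N d is the volume of the slab relative to the cube *)
pose N := n%:R * C ^+ n.-1; have N0 : 0 <= N by rewrite mulr_ge0// exprn_ge0// ltW.
pose d := Num.min 1 (e / (N + 1)).
have d0 : 0 < d by rewrite lt_min ltr01 divr_gt0// ltr_wpDl.
have [r r0 rP] := TL d d0; exists r => // b s s0 sub.
have cb : ocube c r b by apply: sub; rewrite /ccube /= subrr normr0 ltW.
pose h j := if j == i0 then n%:R * d * s else C * s.
have h0 j : 0 <= h j by rewrite /h; case: ifP => _; rewrite !mulr_ge0// ltW.
pose A j : set (measurableTypeR R) := `[- h j, h j]%classic.
have mA j : measurable (A j) by exact: measurable_itv.
have [mB BE] := lebesgue_affine_preimage (T b) M0 (measurable_rV_box mA).
eexists; split; [exact: mB| |].
  move=> _ [u bu <-] j /=; rewrite /A /= in_itv /= -ler_norml ME /h.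
  have Tb := rP _ _ (sub _ bu) cb.
  have eb : `|T u - T b - (u - b) *m L| <= d * s.
    by apply: le_trans Tb _; rewrite ler_wpM2l// ltW.
  case: ifP => _.
    have -> : (T u - T b) *m w = (T u - T b - (u - b) *m L) *m w.
      by rewrite [in RHS]mulmxBl -mulmxA Lw mulmx0 subr0.
    rewrite mxE (le_trans (ler_norm_sum _ _ _))// -mulrA.
    apply: le_trans (ler_sum _ (_ : forall i, true -> _ <= d * s)) _.
      move=> i _; rewrite normrM -[leRHS]mulr1 ler_pM//.
      by apply: le_trans (rV_coord_norm _ _) eb.
    by rewrite sumr_const card_ord mulr_natl.
  apply: le_trans (rV_coord_norm _ _) _.
  rewrite -(subrK ((u - b) *m L) (T u - T b)) (le_trans (ler_normD _ _))//.
  rewrite mulrDl addrC; apply: lerD.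
    by apply: le_trans (mulmx_bound _ _) _; rewrite ler_wpM2l// mx_bound_ge0.
  by apply: le_trans eb _; rewrite ler_wpM2r ?(ltW s0)// ge_min lexx.
have -> : leb ((fun y => (y - T b) *m M) @^-1` [set x | forall i, A i (x ord0 i)]) =
    (\prod_j (h j *+ 2))%:E.
  move: BE; rewrite M1 normr1 mul1e => ->; rewrite (lebesgue_rV_box mA) -prodEFin.
  apply: eq_bigr => j _; rewrite lebesgue_measure_itv/= lte_fin.
  case: ltP => hj; first by rewrite -EFinD; congr EFin; rewrite mulr2n; lra.
  by congr EFin; move: (h0 j) hj; rewrite mulr2n; lra.
rewrite lee_fin (bigD1 i0)//= /h eqxx.
rewrite (eq_bigr (fun=> C * s *+ 2)) => [|j /negPf ->//].
rewrite prodr_const (_ : #|_| = n.-1); last first.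
  by have := cardC1 i0; rewrite card_ord => <-; apply: eq_card => j; rewrite inE.
rewrite -!mulrnAr exprMn mulrACA -exprS prednK; last first.
  by rewrite -[n]card_ord; apply/card_gt0P; exists i0.
rewrite ler_wpM2r ?exprn_ge0 ?mulrn_wge0 ?(ltW s0)// mulrAC -/N.
apply: (@le_trans _ _ (N * (e / (N + 1)))).
  by rewrite ler_wpM2l// ge_min lexx orbT.
by rewrite mulrCA ler_piMr ?(ltW e0)// ler_pdivrMr ?ltr_wpDl// mul1r lerDl.
Qed.

Lemma local_volume_upper T c L (e : R) : strict_diff T c L ->
  0 < e -> exists2 r, 0 < r & forall b s, 0 < s -> ccube b s `<=` ocube c r ->
  exists B, [/\ measurable B, T @` ccube b s `<=` B &
    (leb B <= ((`|\det L| + e) * (s *+ 2) ^+ n)%:E)%E].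
Proof.
move=> TL e0; have [L0|L0] := eqVneq (\det L) 0.
  by rewrite L0 normr0 add0r; exact: local_volume_upper_singular TL L0 e0.
exact: local_volume_upper_regular.
Qed.

End local_volume.

(** * Subdivision of cubes *)

Section cube_subdivision.
Context {R : realType} {n : nat}.
Implicit Types (b c x : 'rV[R]_n) (s : R) (o : {ffun 'I_n -> bool}).

Definition subcube b s o : 'rV[R]_n :=
  \row_i (b ord0 i + if o i then s / 2 else - (s / 2)).

Lemma ccube_subcubes b s x : 0 < s -> ccube b s x ->
  exists o, ccube (subcube b s o) (s / 2) x.
Proof.
move=> s0 /(rV_norm_leP _ (ltW s0)) bx.
exists [ffun i => b ord0 i <= x ord0 i].
apply/rV_norm_leP => [|i]; first by rewrite divr_ge0// ltW.
rewrite !mxE ffunE; have := bx i; rewrite !mxE !ler_norml => /andP[h1 h2].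
by case: (leP (b ord0 i) (x ord0 i)) => h; apply/andP; split; lra.
Qed.

Lemma ocube_subcube b s o : 0 < s -> ocube (subcube b s o) (s / 2) `<=` ocube b s.
Proof.
move=> s0 x; have s20 : 0 < s / 2 by rewrite divr_gt0.
move=> /(rV_norm_ltP _ s20) bx; apply/rV_norm_ltP => // i.
have := bx i; rewrite !mxE !ltr_norml => /andP[h1 h2].
by case: (o i) h1 h2 => h1 h2; apply/andP; split; lra.
Qed.

Lemma ocube_subcubes_disjoint b s o o' x : 0 < s ->
  ocube (subcube b s o) (s / 2) x -> ocube (subcube b s o') (s / 2) x -> o = o'.
Proof.
move=> s0; have s20 : 0 < s / 2 by rewrite divr_gt0.
move=> /(rV_norm_ltP _ s20) ox /(rV_norm_ltP _ s20) o'x; apply/ffunP => i.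
move: (ox i) (o'x i); rewrite !mxE !ltr_norml => /andP[h1 h2] /andP[h3 h4].
by case: (o i) h1 h2 => h1 h2; case: (o' i) h3 h4 => h3 h4 //; exfalso; lra.
Qed.

(** If P fails for a cube, it fails for one of its 2^n halves, and so on; these
    cubes shrink to a point, near which P holds by assumption. *)
Lemma cube_induction (P : 'rV[R]_n -> R -> Prop) :
  (forall b s, 0 < s -> (forall o, P (subcube b s o) (s / 2)) -> P b s) ->
  forall b s, 0 < s ->
  (forall c, ccube b s c -> exists2 r, 0 < r & forall b' s', 0 < s' ->
    ccube b' s' c -> ccube b' s' `<=` ocube c r -> P b' s') -> P b s.
Proof.
move=> Psub b s s0 Ploc; apply: contrapT => nP.
have nextP (bs : 'rV[R]_n * R) : exists o,
    0 < bs.2 -> ~ P bs.1 bs.2 -> ~ P (subcube bs.1 bs.2 o) (bs.2 / 2).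
  apply: contrapT => /forallNP h.
  have [bs0|bs0] := pselect (0 < bs.2); last by apply: (h [ffun=> true]).
  have nPbs : ~ P bs.1 bs.2.
    by move=> Pbs; apply: (h [ffun=> true]) => _ /(_ Pbs).
  apply: nPbs; apply: Psub => // o; apply: contrapT => nPo.
  by apply: (h o).
have [next {}nextP] := choice nextP.
pose q (bs : 'rV[R]_n * R) := (subcube bs.1 bs.2 (next bs), bs.2 / 2).
pose B k := (iter k q (b, s)).1; pose S k := (iter k q (b, s)).2.
have S0 k : 0 < S k by elim: k => //= k IH; rewrite /S /= divr_gt0.
have SE k : S k.+1 = S k / 2 by [].
have nPk k : ~ P (B k) (S k).
  by elim: k => //= k IH; apply: nextP => //; exact: S0.
have step k i : `|B k.+1 ord0 i - B k ord0 i| = S k / 2.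
  rewrite /B /= mxE addrC addKr; case: ifP => _; rewrite ?normrN ger0_norm//;
  by rewrite divr_ge0// ltW// S0.
have up k i : B k.+1 ord0 i + S k.+1 <= B k ord0 i + S k.
  by have := step k i; rewrite SE => /eqP; rewrite eq_le ler_norml => /andP[/andP[? ?] _]; lra.
have lo k i : B k ord0 i - S k <= B k.+1 ord0 i - S k.+1.
  by have := step k i; rewrite SE => /eqP; rewrite eq_le ler_norml => /andP[/andP[? ?] _]; lra.
have ups k l i : (k <= l)%N -> B l ord0 i + S l <= B k ord0 i + S k.
  move=> /subnK <-; elim: (l - k)%N => // j; exact/le_trans/up.
have los k l i : (k <= l)%N -> B k ord0 i - S k <= B l ord0 i - S l.
  move=> /subnK <-; elim: (l - k)%N => // j /le_trans; apply; exact: lo.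
have loup k l i : B k ord0 i - S k <= B l ord0 i + S l.
  have [kl|/ltnW lk] := leqP k l.
    by apply: le_trans (los _ _ i kl) _; have := S0 l; lra.
  by apply: le_trans (ups _ _ i lk); have := S0 k; lra.
pose E i := [set B k ord0 i - S k | k in setT].
have Esup i : has_sup (E i).
  split; first by exists (B 0%N ord0 i - S 0%N); exists 0%N.
  by exists (B 0%N ord0 i + S 0%N) => _ [k _ <-].
(* the supremum of the lower faces lies in all the nested intervals *)
pose c : 'rV[R]_n := \row_i sup (E i).
have cB k : ccube (B k) (S k) c.
  apply/rV_norm_leP => [|i]; first exact: ltW.
  rewrite !mxE ler_distl; apply/andP; split.
    by apply: sup_upper_bound => //; exists k.
  by apply: ge_sup => [|_ [l _ <-]]; [case: (Esup i)|exact: loup].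
have [r r0 rP] := Ploc c (cB 0%N).
have [k kr] : exists k, S k *+ 2 < r.
  have SE' k : S k = s * (1 / 2) ^+ k.
    by elim: k => [|k IH]; rewrite ?mulr1// SE IH exprS; field.
  have := @cvg_geometric R s (1 / 2); rewrite ger0_norm ?divr_ge0// => /(_ ltac:(lra)).
  move=> /cvgrPdist_lt/(_ (r / 2)); rewrite divr_gt0// => /(_ isT)[k _ /(_ k (leqnn k))].
  rewrite sub0r normrN /geometric /= -SE' => h; exists k.
  move: h; rewrite (ger0_norm (ltW (S0 k))) => h.
  by rewrite mulr2n (splitr r) ltrD.
apply: (nPk k); apply: rP => // x xB; apply: le_lt_trans kr.
rewrite -(subrK (B k) x) -addrA (le_trans (ler_normD _ _))// mulr2n lerD//.
by rewrite distrC; exact: cB.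
Qed.

End cube_subdivision.

Section finite_additivity.
Context d (T : measurableType d) (R : realType) (mu : {measure set T -> \bar R}).
Variables (I : finType) (F : I -> set T) (A : set T) (g : T -> \bar R).
Hypotheses (mA : measurable A) (mF : forall i, measurable (F i)).

(** Finite subadditivity over a cover, and below superadditivity over disjoint
    parts: together they let an inequality between integrals pass from the
    halves of a cube to the cube.  Closed cubes are used on the side that needs
    a cover, open ones on the side that needs disjointness. *)
Lemma ge0_integral_le_cover : measurable_fun setT g -> (forall x, 0 <= g x)%E ->
  A `<=` \bigcup_i F i -> (\int[mu]_(x in A) g x <= \sum_i \int[mu]_(x in F i) g x)%E.
Proof.
move=> mg g0 AF.
under eq_bigr do rewrite integral_mkcond.
have mgF (B : set T) : measurable B -> measurable_fun setT (g \_ B).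
  by move=> mB; apply/(measurable_restrictT _ mB); exact: measurable_funTS.
rewrite integral_mkcond -ge0_integral_sum//; last 2 first.
- by move=> i; exact: mgF.
- by move=> i x _; apply: erestrict_ge0.
apply: ge0_le_integral => //.
- by move=> x _; apply: erestrict_ge0.
- exact: mgF.
- by apply: emeasurable_sum => i; exact: mgF.
move=> x _; rewrite {1}patchE; case: ifPn => [/set_mem/AF[i _ Fix]|_]; last first.
  by apply: sume_ge0 => i _; exact: erestrict_ge0.
rewrite (bigD1 i)//= patchE mem_set// leeDl//.
by apply: sume_ge0 => j _; exact: erestrict_ge0.
Qed.

Lemma ge0_integral_ge_disjoint : measurable_fun A g -> (forall x, A x -> 0 <= g x)%E ->
  (forall i, F i `<=` A) -> (forall i j x, F i x -> F j x -> i = j) ->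
  (\sum_i \int[mu]_(x in F i) g x <= \int[mu]_(x in A) g x)%E.
Proof.
move=> mg g0 FA tF.
under eq_bigr do rewrite integral_mkcond.
have mgF i : measurable_fun setT (g \_ (F i)).
  by apply/(measurable_restrictT _ (mF i)); exact: measurable_funS mg.
have gF0 i x : (0 <= (g \_ (F i)) x)%E by apply: erestrict_ge0 => y /FA; exact: g0.
rewrite [leRHS]integral_mkcond -ge0_integral_sum//.
apply: ge0_le_integral => //.
- by move=> x _; apply: sume_ge0.
- by apply: emeasurable_sum.
- exact/(measurable_restrictT _ mA).
move=> x _; have [[i Fix]|nF] := pselect (exists i, F i x); last first.
  rewrite big1 => [|i _]; first by apply: erestrict_ge0.
  by rewrite patchE memNset// => Fix; apply: nF; exists i.
rewrite (bigD1 i)//= big1 ?adde0 => [|j ji].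
  by rewrite !patchE !mem_set//; exact: (FA i).
by rewrite patchE memNset// => Fjx; case/eqP: ji; exact: tF Fjx Fix.
Qed.

End finite_additivity.

(** * The area inequalities *)

Section area_inequalities.
Context {R : realType} {n : nat}.
Notation leb := (lebesgue_rV n).
Implicit Types (b c x y : 'rV[R]_n) (s r e : R).

Lemma continuous_at_ocube (g : 'rV[R]_n -> R) c e : 0 < e -> {for c, continuous g} ->
  exists2 r, 0 < r & forall x, ocube c r x -> `|g x - g c| <= e.
Proof.
move=> e0 /cvgrPdist_le/(_ _ e0)/nbhs_ballP[r /= r0 h]; exists r => // x.
by rewrite ocube_ball distrC => /h.
Qed.

Lemma open_ocube (U : set 'rV[R]_n) c : open U -> U c ->
  exists2 r, 0 < r & ocube c r `<=` U.
Proof.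
move=> oU Uc; have /nbhs_ballP[r /= r0 h] := open_nbhs_nbhs (conj oU Uc).
by exists r => //; rewrite ocube_ball.
Qed.

Lemma strict_diff_continuous (T : 'rV[R]_n -> 'rV[R]_n) c L :
  strict_diff T c L -> {for c, continuous T}.
Proof.
move=> /(_ _ ltr01)[r r0 rP].
apply/(@cvgrPdist_le _ _ _ (nbhs c) (nbhs_filter c)) => e e0.
pose C := mx_bound L + 1; have C0 : 0 < C by rewrite ltr_wpDl// mx_bound_ge0.
apply/nbhs_ballP; exists (Num.min r (e / C)); first by rewrite /= lt_min r0 divr_gt0.
move=> x; rewrite -ocube_ball /ocube /= lt_min => /andP[xr xe].
have := rP x c xr; rewrite /ocube /= subrr normr0 => /(_ r0) h.
rewrite distrC -(subrK ((x - c) *m L) (T x - T c)) (le_trans (ler_normD _ _))//.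
have h' := mulmx_bound (x - c) L.
apply: (@le_trans _ _ (C * `|x - c|)); first by rewrite /C mulrDl addrC lerD.
by rewrite mulrC -ler_pdivlMr// ltW.
Qed.

Lemma sum_subcubes e s : 0 < s ->
  (\sum_(o : {ffun 'I_n -> bool}) (e * (s / 2 *+ 2) ^+ n)%:E = (e * (s *+ 2) ^+ n)%:E)%E.
Proof.
move=> s0; rewrite sumEFin; congr EFin.
rewrite sumr_const card_ffun card_bool card_ord -[LHS]mulr_natl natrX.
by rewrite mulrCA -exprMn; congr (_ * _ ^+ _); rewrite !mulr2n; field.
Qed.

(** The points at distance at least 1/(k+1) from the complement: closed sets
    exhausting an open set. *)
Definition inner_part (U : set 'rV[R]_n) (k : nat) : set 'rV[R]_n :=
  [set x | forall z, ~ U z -> k.+1%:R^-1 <= `|x - z|].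

Lemma inner_part_sub U k : inner_part U k `<=` U.
Proof.
move=> x xU; apply: contrapT => /xU; rewrite subrr normr0 leNgt.
by rewrite invr_gt0 ltr0Sn.
Qed.

Lemma inner_part_closed U k : closed (inner_part U k).
Proof.
rewrite (_ : inner_part U k = ~` \bigcup_(z in ~` U) ocube z k.+1%:R^-1).
  by apply: open_closedC; apply: bigcup_open => z _; exact: ocube_open.
apply/seteqP; split => x /= xU; first by move=> [z /xU zx]; rewrite /ocube /= ltNge zx.
by move=> z nUz; rewrite leNgt; apply/negP => xz; apply: xU; exists z.
Qed.

Lemma inner_part_nondecreasing U k l : (k <= l)%N -> inner_part U k `<=` inner_part U l.
Proof.
move=> kl x xU z /xU; apply: le_trans.
by rewrite lef_pV2 ?posrE ?ltr0Sn// ler_nat ltnS.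
Qed.

Lemma bigcup_inner_part U : open U -> \bigcup_k inner_part U k = U.
Proof.
move=> oU; apply/seteqP; split => [x [k _ /inner_part_sub//]|x Ux].
have [r r0 rU] := open_ocube oU Ux.
have [k] := ltr_add_invr r0; rewrite add0r => kr; exists k => // z nUz.
apply: le_trans (ltW kr) _; rewrite leNgt; apply/negP => xz; apply: nUz.
by apply: rU; rewrite /ocube /= distrC.
Qed.

Variables (U : set 'rV[R]_n) (b0 : 'rV[R]_n) (s0 : R).
Variables (T : 'rV[R]_n -> 'rV[R]_n) (H : 'rV[R]_n -> 'M[R]_n) (f g : 'rV[R]_n -> R).
Hypotheses (oU : open U) (s0_gt0 : 0 < s0) (Ub0 : U `<=` ocube b0 s0).
Let J x := `|\det (H x)|.
Hypothesis TH : forall c, U c -> strict_diff T c (H c).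
Hypothesis cJ : forall c, U c -> {for c, continuous J}.
Hypothesis cf : forall c, U c -> {for c, continuous f}.
Hypothesis f0 : forall x, U x -> 0 <= f x.
Hypotheses (mg : measurable_fun setT g) (g0 : forall y, 0 <= g y).

Let J0 x : 0 <= J x. Proof. exact: normr_ge0. Qed.

Let fJ0 x : U x -> (0 <= (f x * J x)%:E)%E.
Proof. by move=> /f0 fx; rewrite lee_fin mulr_ge0. Qed.

Let cfJ c : U c -> {for c, continuous (fun x => f x * J x)}.
Proof. by move=> Uc; exact: (continuousM (cf Uc) (cJ Uc)). Qed.

Let mfJ : measurable_fun U (fun x => (f x * J x)%:E).
Proof. by apply/measurable_EFinP; exact: open_continuous_measurable_rV. Qed.

Let mgE : measurable_fun setT (EFin \o g).
Proof. exact/measurable_EFinP. Qed.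

Let measurable_image_compact (K : set 'rV[R]_n) : compact K -> K `<=` U ->
  measurable (T @` K).
Proof.
move=> cK KU; apply: closed_measurable_rV; apply: compact_closed.
  exact: norm_hausdorff.
apply: continuous_compact => //; apply: continuous_in_subspaceT => x /set_mem/KU Ux.
exact: strict_diff_continuous (TH Ux).
Qed.

Let mopen (V : set 'rV[R]_n) : open V -> measurable V := @open_measurable_rV _ _ V.

Let lee_eps (x y : \bar R) :
  (forall e, 0 < e -> (x <= y + (e * (s0 *+ 2) ^+ n)%:E)%E) -> (x <= y)%E.
Proof.
move=> h; apply/lee_addgt0Pr => e e0.
have s2 : 0 < (s0 *+ 2) ^+ n by rewrite exprn_gt0// pmulrn_lgt0.
by have := h (e / (s0 *+ 2) ^+ n); rewrite divr_gt0// divfK ?gt_eqF// => /(_ isT).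
Qed.

Let oU0 : ocube b0 s0 `&` U = U. Proof. exact/setIidr. Qed.

Section upper.
Hypothesis gf : forall x, U x -> g (T x) <= f x.

(** On a small cube f, f J and the volume of the image are all controlled by
    their values at c. *)
Lemma area_upper_local c e : U c -> 0 < e -> exists2 r, 0 < r &
  forall b s (A : set 'rV[R]_n), 0 < s -> ccube b s `<=` ocube c r -> A `<=` ccube b s ->
  measurable (T @` A) ->
  (\int[leb]_(y in T @` A) (g y)%:E <=
   \int[leb]_(x in ocube b s `&` U) (f x * J x)%:E + (e * (s *+ 2) ^+ n)%:E)%E.
Proof.
move=> Uc e0.
have [d d0 dP] : exists2 d, 0 < d & (f c + d) * (J c + d) <= f c * J c + e / 2.
  have e20 : 0 < e / 2 by rewrite divr_gt0.
  have [d d0 h] := poly_near0 (((f c)%:P + 'X) * ((J c)%:P + 'X)) e20.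
  exists d => //; have := h d; rewrite (ltW d0) lexx !hornerE => /(_ isT).
  by move=> /(le_trans (ler_norm _)); rewrite ?addr0 lerBlDl.
have [rU rU0 rUP] := open_ocube oU Uc.
have [rf rf0 rfP] := continuous_at_ocube d0 (cf Uc).
have e20 : 0 < e / 2 by rewrite divr_gt0.
have [rJ rJ0 rJP] := continuous_at_ocube e20 (cfJ Uc).
have [rV rV0 rVP] := local_volume_upper (TH Uc) d0.
exists (Num.min (Num.min rU rf) (Num.min rJ rV)).
  by rewrite !lt_min rU0 rf0 rJ0 rV0.
move=> b s A s0' sub Ab mTA.
have subr x : ccube b s x -> [/\ ocube c rU x, ocube c rf x, ocube c rJ x & ocube c rV x].
  by move=> /sub; rewrite /ocube /= !lt_min => /andP[/andP[-> ->] /andP[-> ->]].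
have [B [mB TB BV]] := rVP b s s0' (fun x bx => let: And4 _ _ _ h := subr x bx in h).
have fcd : 0 <= f c + d by rewrite addr_ge0 ?f0// ltW.
apply: (@le_trans _ _ (((f c + d) * (J c + d) * (s *+ 2) ^+ n)%:E)).
  apply: (@le_trans _ _ (\int[leb]_(y in T @` A) (cst (f c + d)%:E) y)%E).
    apply: ge0_le_integral => //; first by move=> y _; rewrite lee_fin.
    - exact: measurable_funTS.
    - move=> _ [x Ax <-] /=; rewrite lee_fin.
      have [Ux fx _ _] := subr x (Ab x Ax).
      apply: le_trans (gf (rUP _ Ux)) _; have := rfP x fx.
      by rewrite ler_norml => /andP[_]; rewrite lerBlDl.
  rewrite integral_cst// -mulrA EFinM; apply: lee_wpmul2l; rewrite ?lee_fin//.
  apply: le_trans BV; apply: le_measure; rewrite ?inE// => y [x Ax <-].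
  by apply: TB; exists x => //; exact: Ab.
have oU' : ocube b s `&` U = ocube b s.
  by apply/setIidl => x /ocubeW/subr[/rUP].
rewrite oU'; have sn0 : 0 <= (s *+ 2) ^+ n by rewrite exprn_ge0// mulrn_wge0// ltW.
apply: (@le_trans _ _ ((f c * J c + e / 2) * (s *+ 2) ^+ n)%:E).
  by rewrite lee_fin ler_wpM2r.
have mo := ocube_measurable b s.
have oU1 : ocube b s `<=` U by move=> x /ocubeW/subr[/rUP].
have mfJo := measurable_funS (mopen oU) oU1 mfJ.
have oc : (\int[leb]_(x in ocube b s) (cst (e / 2)%:E) x = (e / 2 * (s *+ 2) ^+ n)%:E)%E.
  rewrite integral_cst//; transitivity ((e / 2)%:E * leb (ocube b s))%E => //.
  by rewrite lebesgue_ocube// -EFinM.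
have -> : (e * (s *+ 2) ^+ n)%:E = ((e / 2 * (s *+ 2) ^+ n)%:E + (e / 2 * (s *+ 2) ^+ n)%:E)%E.
  by rewrite -EFinD; congr EFin; field.
rewrite addeA -[X in (_ + X + _)%E]oc mulrDl EFinD leeD2r//.
rewrite -ge0_integralD//; last 2 first.
- by move=> x /oU1; exact: fJ0.
- by move=> x _; rewrite /= lee_fin ltW.
apply: (@le_trans _ _ (\int[leb]_(x in ocube b s) (cst (f c * J c)%:E) x)%E).
  rewrite integral_cst// EFinM; apply: lee_wpmul2l; first exact: fJ0.
  by rewrite -(lebesgue_ocube b s0').
apply: ge0_le_integral => //.
- by move=> x _; exact: fJ0.
- exact: emeasurable_funD.
move=> x /ocubeW/subr[_ _ /rJP + _].
by rewrite ler_norml => /andP[+ _]; rewrite /= -EFinD lee_fin; lra.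
Qed.

(** Replacing U by a closed K on the left only: away from K the left-hand side
    is zero for small cubes, and near K small cubes lie in U, so that the local
    hypothesis of [cube_induction] holds everywhere, the boundary of U
    included.  The extra term e |cube| is additive and absorbs the local
    errors. *)
Lemma area_upper_closed (K : set 'rV[R]_n) : closed K -> K `<=` U ->
  (\int[leb]_(y in T @` K) (g y)%:E <= \int[leb]_(x in U) (f x * J x)%:E)%E.
Proof.
move=> cK KU; apply: lee_eps => e e0; rewrite -[in leRHS]oU0.
have mTK b s : measurable (T @` (ccube b s `&` K)).
  apply: measurable_image_compact; last by move=> x [_ /KU].
  by apply: compact_closedI => //; exact: ccube_compact.
have -> : K = ccube b0 s0 `&` K.
  by apply/esym/setIidr => x /KU/Ub0/ocubeW.
pose P b s := (\int[leb]_(y in T @` (ccube b s `&` K)) (g y)%:E <=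
  \int[leb]_(x in ocube b s `&` U) (f x * J x)%:E + (e * (s *+ 2) ^+ n)%:E)%E.
apply: (@cube_induction _ _ P) => // [b s s0' Po|c _].
  apply: le_trans (ge0_integral_le_cover leb (F := fun o : {ffun 'I_n -> bool} =>
    T @` (ccube (subcube b s o) (s / 2) `&` K)) _ _ mgE _ _) _ => //.
    move=> _ [x [bx Kx] <-]; have [w xw] := ccube_subcubes s0' bx.
    by exists w => //; exists x.
  apply: le_trans (lee_sum _ (fun o _ => Po o)) _.
  rewrite big_split/= sum_subcubes// leeD2r//.
  apply: (ge0_integral_ge_disjoint leb (F := fun o : {ffun 'I_n -> bool} =>
    ocube (subcube b s o) (s / 2) `&` U)) => //.
  - by apply: measurableI; [exact: ocube_measurable|exact: mopen].
  - by move=> o; apply: measurableI; [exact: ocube_measurable|exact: mopen].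
  - apply: measurable_funS mfJ => //; first exact: mopen.
  - by move=> x [_]; exact: fJ0.
  - by move=> o; apply: setSI; exact: ocube_subcube.
  - by move=> o o' x [xo _] [xo' _]; exact: ocube_subcubes_disjoint xo xo'.
have [Kc|nKc] := pselect (K c).
  have [r r0 rP] := area_upper_local (KU _ Kc) e0.
  by exists r => // b s s0' _ sub; apply: rP => // x [].
have [r r0 rK] := open_ocube (closed_openC cK) nKc.
exists r => // b s s0' _ sub; rewrite /P (_ : _ `&` K = set0); last first.
  by apply/seteqP; split => // x [/sub/rK].
rewrite image_set0 integral_set0; apply: adde_ge0.
  by apply: integral_ge0 => x [_]; exact: fJ0.
by rewrite lee_fin mulr_ge0 ?(ltW e0)// exprn_ge0// mulrn_wge0// ltW.
Qed.

(** Half of the change of variables formula; T need not be injective, and the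
    critical points of T contribute nothing. *)
Lemma area_upper : (forall y, ~ (T @` U) y -> g y = 0) ->
  (\int[leb]_y (g y)%:E <= \int[leb]_(x in U) (f x * J x)%:E)%E.
Proof.
move=> gTU.
have mTK k : measurable (T @` inner_part U k).
  apply: measurable_image_compact; last exact: inner_part_sub.
  rewrite (_ : inner_part U k = ccube b0 s0 `&` inner_part U k).
    apply: compact_closedI; first exact: ccube_compact.
    exact: inner_part_closed.
  by apply/esym/setIidr => x /inner_part_sub/Ub0/ocubeW.
have -> : (\int[leb]_y (g y)%:E =
    \int[leb]_(y in \bigcup_k (T @` inner_part U k)) (g y)%:E)%E.
  rewrite [RHS]integral_mkcond; apply: eq_integral => y _.
  rewrite patchE; case: ifPn => // /negP; rewrite inE => ny.
  rewrite gTU// => -[x Ux xy]; apply: ny.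
  move: Ux; rewrite -{1}(bigcup_inner_part oU) => -[k _ kx].
  by exists k => //; exists x.
have cvgT := @ge0_nondecreasing_set_cvg_integral _ _ R
  (fun k => T @` inner_part U k) (EFin \o g) leb.
rewrite -(cvg_lim _ (cvgT _ _ _ _))//.
- apply: lime_le; first by apply/cvg_ex; eexists; apply: cvgT => //;
    [move=> k l kl; apply/subsetPset; apply: image_subset; exact: inner_part_nondecreasing
    |by move=> k; exact: measurable_funTS|by move=> k y _; rewrite lee_fin].
  apply: nearW => k; apply: area_upper_closed; first exact: inner_part_closed.
  exact: inner_part_sub.
- by move=> k l kl; apply/subsetPset; apply: image_subset; exact: inner_part_nondecreasing.
- by move=> k; exact: measurable_funTS.
- by move=> k y _; rewrite lee_fin.
Qed.

End upper.

Section lower.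
Let D0 := [set x | U x /\ J x != 0].
Hypothesis Tinj : forall x y, D0 x -> D0 y -> T x = T y -> x = y.
Hypothesis fg : forall x, D0 x -> f x <= g (T x).

Let D0U : D0 `<=` U. Proof. by move=> x []. Qed.

Let oD0 : open D0.
Proof.
rewrite openE => c [Uc Jc]; have J0c : 0 < J c by rewrite lt_neqAle eq_sym Jc J0.
have [rU rU0 rUP] := open_ocube oU Uc.
have J2 : 0 < J c / 2 by rewrite divr_gt0.
have [rJ rJ0 rJP] := continuous_at_ocube J2 (cJ Uc).
apply/nbhs_ballP; exists (Num.min rU rJ); first by rewrite /= lt_min rU0.
move=> x; rewrite -ocube_ball /ocube /= lt_min => /andP[xU /rJP].
rewrite ler_norml => /andP[h _]; split; first exact: rUP.
by rewrite gt_eqF//; lra.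
Qed.

Let det_neq0 c : D0 c -> \det (H c) != 0.
Proof. by move=> [_]; rewrite /J normr_eq0. Qed.

Let open_image (V : set 'rV[R]_n) : open V -> open (T @` (V `&` D0)).
Proof.
move=> oV; rewrite openE => _ [c [Vc Dc] <-].
have [r1 r10 r1P] := open_ocube (openI oV oD0) (conj Vc Dc).
have [r2 r20 r2P] := local_volume_lower (TH (D0U Dc)) (det_neq0 Dc) ltr01.
pose s := Num.min r1 r2 / 2.
have m0 : 0 < Num.min r1 r2 by rewrite lt_min r10.
have s_gt0 : 0 < s by rewrite divr_gt0.
have sub x : ccube c s x -> ocube c r1 x /\ ocube c r2 x.
  rewrite /ccube /ocube /= => h; apply/andP; rewrite -lt_min (le_lt_trans h)//.
  by rewrite /s; lra.
have [B [oB Bc BT _]] := r2P c s s_gt0 (fun x bx => (sub x bx).2).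
apply: filterS (open_nbhs_nbhs (conj oB Bc)) => y /BT[x xs <-].
by exists x => //; apply: r1P; exact: (sub x (ocubeW xs)).1.
Qed.

(** Where J c = 0 the left-hand side is negligible on small cubes; elsewhere
    the image of a small cube contains a set of the right volume. *)
Lemma area_lower_local c e : U c -> 0 < e -> exists2 r, 0 < r &
  forall b s (A : set 'rV[R]_n), 0 < s -> ccube b s `<=` ocube c r -> A `<=` ccube b s ->
  measurable A ->
  (\int[leb]_(x in A) (f x * J x)%:E <=
   \int[leb]_(y in T @` (ocube b s `&` D0)) (g y)%:E + (e * (s *+ 2) ^+ n)%:E)%E.
Proof.
move=> Uc e0; have e20 : 0 < e / 2 by rewrite divr_gt0.
have [rU rU0 rUP] := open_ocube oU Uc.
have [rJ rJ0 rJP] := continuous_at_ocube e20 (cfJ Uc).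
have bound b s (A : set 'rV[R]_n) (a : R) : 0 < s -> ccube b s `<=` U -> A `<=` ccube b s ->
    measurable A -> 0 <= a -> (forall x, A x -> f x * J x <= a) ->
    (\int[leb]_(x in A) (f x * J x)%:E <= (a * (s *+ 2) ^+ n)%:E)%E.
  move=> s0' bU Ab mA a0 fJa.
  apply: (@le_trans _ _ (\int[leb]_(x in A) (cst a%:E) x)%E).
    apply: ge0_le_integral => //.
    - by move=> x /Ab/bU; exact: fJ0.
    - by apply: measurable_funS mfJ => //; [exact: mopen|move=> x /Ab/bU].
  rewrite integral_cst// EFinM; apply: lee_wpmul2l; first by rewrite lee_fin.
  rewrite -(lebesgue_ccube b (ltW s0')); apply: le_measure; rewrite ?inE//.
  exact: ccube_measurable.
have [Jc|Jc] := eqVneq (J c) 0.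
  exists (Num.min rU rJ) => [|b s A s0' sub Ab mA]; first by rewrite lt_min rU0.
  have subr x : ccube b s x -> ocube c rU x /\ ocube c rJ x.
    by move=> /sub; rewrite /ocube /= lt_min => /andP[].
  apply: (@le_trans _ _ (e * (s *+ 2) ^+ n)%:E).
    apply: (bound b s A e s0' _ Ab mA (ltW e0)); first by move=> x /subr[/rUP].
    move=> x /Ab/subr[_ /rJP]; rewrite Jc mulr0 subr0 => h.
    by apply: le_trans (ler_norm _) _; apply: le_trans h _; lra.
  by rewrite leeDr//; apply: integral_ge0 => y _; rewrite lee_fin.
have Dc : D0 c by [].
have J0c : 0 < J c by rewrite lt_neqAle eq_sym Jc J0.
have [rD rD0 rDP] := open_ocube oD0 Dc.
have [d d0 [dJ dP]] : exists2 d, 0 < d & d <= J c /\ f c * J c - e / 2 <= (f c - d) * (J c - d).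
  have [d d0 h] := poly_near0 (((f c)%:P - 'X) * ((J c)%:P - 'X)) e20.
  exists (Num.min d (J c)); first by rewrite lt_min d0.
  split; first by rewrite ge_min lexx orbT.
  have := h (Num.min d (J c)); rewrite le_min (ltW d0) (ltW J0c) ge_min lexx !hornerE => /(_ isT).
  by rewrite ?subr0 ler_norml => /andP[+ _]; rewrite lerBrDl addrC.
have [rf rf0 rfP] := continuous_at_ocube d0 (cf Uc).
have [rV rV0 rVP] := local_volume_lower (TH Uc) (det_neq0 Dc) d0.
exists (Num.min (Num.min rD rf) (Num.min rJ rV)).
  by rewrite !lt_min rD0 rf0 rJ0 rV0.
move=> b s A s0' sub Ab mA.
have subr x : ccube b s x -> [/\ ocube c rD x, ocube c rf x, ocube c rJ x & ocube c rV x].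
  by move=> /sub; rewrite /ocube /= !lt_min => /andP[/andP[-> ->] /andP[-> ->]].
have [B [oB _ BT BV]] := rVP b s s0' (fun x bx => let: And4 _ _ _ h := subr x bx in h).
have cD : ccube b s `<=` D0 by move=> x /subr[/rDP].
rewrite (_ : ocube b s `&` D0 = ocube b s); last by apply/setIidl => x /ocubeW/cD.
have sn0 : 0 <= (s *+ 2) ^+ n by rewrite exprn_ge0// mulrn_wge0// ltW.
apply: (@le_trans _ _ ((f c * J c + e / 2) * (s *+ 2) ^+ n)%:E).
  have fJe : 0 <= f c * J c + e / 2 by rewrite addr_ge0 ?(ltW e20)// mulr_ge0// f0.
  apply: (bound b s A _ s0' _ Ab mA fJe); first by move=> x /cD[].
  move=> x /Ab/subr[_ _ /rJP + _].
  by rewrite ler_norml => /andP[_]; rewrite lerBlDl.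
have -> : (f c * J c + e / 2) * (s *+ 2) ^+ n =
  (f c * J c - e / 2) * (s *+ 2) ^+ n + e * (s *+ 2) ^+ n by field.
rewrite EFinD leeD2r//; pose a := Num.max 0 (f c - d).
have a0 : 0 <= a by rewrite le_max lexx.
have mT : measurable (T @` ocube b s).
  rewrite -(_ : ocube b s `&` D0 = ocube b s); last by apply/setIidl => x /ocubeW/cD.
  by apply: mopen; apply: open_image; exact: ocube_open.
apply: (@le_trans _ _ (\int[leb]_(y in T @` ocube b s) (cst a%:E) y)%E); last first.
  apply: ge0_le_integral => //.
  - exact: measurable_funTS.
  - move=> _ [x /ocubeW bx <-]; rewrite lee_fin ge_max g0/=.
    apply: le_trans (fg (cD _ bx)); have [_ /rfP + _ _] := subr x bx.
    by rewrite ler_norml => /andP[+ _]; rewrite lerBrDl addrC.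
rewrite integral_cst//.
apply: (@le_trans _ _ (a%:E * leb B)%E); last first.
  by apply: lee_wpmul2l; rewrite ?lee_fin//; apply: le_measure; rewrite ?inE//; exact: mopen.
apply: (@le_trans _ _ (a%:E * ((J c - d) * (s *+ 2) ^+ n)%:E)%E); last first.
  by apply: lee_wpmul2l; rewrite ?lee_fin.
rewrite -EFinM lee_fin mulrA ler_wpM2r//; apply: le_trans dP _.
by rewrite ler_wpM2r ?subr_ge0// le_max lexx orbT.
Qed.

(** The images of disjoint cubes are disjoint only on the set D0 of regular
    points, where T is injective; hence the right-hand side uses D0 and the
    left-hand side does not. *)
Lemma area_lower_closed (K : set 'rV[R]_n) : closed K -> K `<=` U ->
  (\int[leb]_(x in K) (f x * J x)%:E <= \int[leb]_y (g y)%:E)%E.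
Proof.
move=> cK KU; apply: lee_eps => e e0.
have mTD b s : measurable (T @` (ocube b s `&` D0)).
  by apply: mopen; apply: open_image; exact: ocube_open.
have mcK b s : measurable (ccube b s `&` K).
  by apply: measurableI; [exact: ccube_measurable|exact: closed_measurable_rV].
have -> : K = ccube b0 s0 `&` K.
  by apply/esym/setIidr => x /KU/Ub0/ocubeW.
pose P b s := (\int[leb]_(x in ccube b s `&` K) (f x * J x)%:E <=
  \int[leb]_(y in T @` (ocube b s `&` D0)) (g y)%:E + (e * (s *+ 2) ^+ n)%:E)%E.
suff /le_trans : P b0 s0.
  by apply; rewrite leeD2r//; apply: ge0_subset_integral => // y _; rewrite lee_fin.
apply: (@cube_induction _ _ P) => // [b s s0' Po|c _].
  apply: (@le_trans _ _ (\sum_(w : {ffun 'I_n -> bool})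
      \int[leb]_(x in ccube (subcube b s w) (s / 2) `&` K) (f x * J x)%:E)%E).
    pose h := (fun x => (f x * J x)%:E) \_ U.
    have hE A : A `<=` K -> (\int[leb]_(x in A) (f x * J x)%:E = \int[leb]_(x in A) h x)%E.
      move=> AK; apply: eq_integral => x /set_mem/AK/KU Ux.
      by rewrite /h patchE mem_set.
    rewrite (hE _ (@subIsetr _ _ _)).
    under eq_bigr do rewrite (hE _ (@subIsetr _ _ _)).
    apply: (ge0_integral_le_cover leb (F := fun w : {ffun 'I_n -> bool} =>
      ccube (subcube b s w) (s / 2) `&` K)) => //.
    - by apply/(measurable_restrictT _ (mopen oU)).
    - by move=> x; apply: erestrict_ge0; exact: fJ0.
    - move=> x [bx Kx]; have [w xw] := ccube_subcubes s0' bx.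
      by exists w.
  apply: le_trans (lee_sum _ (fun o _ => Po o)) _.
  rewrite big_split/= sum_subcubes// leeD2r//.
  apply: (ge0_integral_ge_disjoint leb (F := fun w : {ffun 'I_n -> bool} =>
    T @` (ocube (subcube b s w) (s / 2) `&` D0))) => //.
  - exact: measurable_funTS.
  - by move=> y _; rewrite lee_fin.
  - by move=> w _ [x [/(ocube_subcube s0') bx Dx] <-]; exists x.
  - move=> w w' y [x [xw Dx] <-] [x' [xw' Dx']] xx'.
    rewrite (Tinj Dx' Dx xx') in xw'.
    exact: ocube_subcubes_disjoint xw xw'.
have [Kc|nKc] := pselect (K c).
  have [r r0 rP] := area_lower_local (KU _ Kc) e0.
  by exists r => // b s s0' _ sub; apply: rP => // x [].
have [r r0 rK] := open_ocube (closed_openC cK) nKc.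
exists r => // b s s0' _ sub; rewrite /P (_ : _ `&` K = set0); last first.
  by apply/seteqP; split => // x [/sub/rK].
rewrite integral_set0; apply: adde_ge0.
  by apply: integral_ge0 => y _; rewrite lee_fin.
by rewrite lee_fin mulr_ge0 ?(ltW e0)// exprn_ge0// mulrn_wge0// ltW.
Qed.

Lemma area_lower :
  (\int[leb]_(x in U) (f x * J x)%:E <= \int[leb]_y (g y)%:E)%E.
Proof.
have mK k : measurable (inner_part U k).
  exact: (closed_measurable_rV (@inner_part_closed U k)).
suff : (\int[leb]_(x in \bigcup_k inner_part U k) (f x * J x)%:E <=
    \int[leb]_y (g y)%:E)%E by rewrite (bigcup_inner_part oU).
have cvgT := @ge0_nondecreasing_set_cvg_integral _ _ R
  (inner_part U) (fun x => (f x * J x)%:E) leb.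
have nd : {homo inner_part U : k l / (k <= l)%N >-> (k <= l)%O}.
  by move=> k l kl; apply/subsetPset; exact: inner_part_nondecreasing.
have mfk k : measurable_fun (inner_part U k) (fun x => (f x * J x)%:E).
  exact: (measurable_funS (mopen oU) (@inner_part_sub U k) mfJ).
have fk k x : inner_part U k x -> (0 <= (f x * J x)%:E)%E.
  by move=> kx; apply: fJ0; exact: (@inner_part_sub U k x kx).
rewrite -(cvg_lim _ (cvgT nd mK mfk fk))//; apply: lime_le.
  exact: cvgP (cvgT nd mK mfk fk).
by apply: nearW => k; exact: (area_lower_closed (@inner_part_closed U k) (@inner_part_sub U k)).
Qed.

End lower.

End area_inequalities.

(** * The simplex and its chart *)

Section simplex_chart.
Context {R : realType} (m : nat).
Hypothesis m0 : (0 < m)%N.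
Notation n := m.+1.
Notation chart := (@chart R m.+1).
Implicit Types (p x : 'rV[R]_n) (q y v : 'rV[R]_m).

Definition chart_proj p : 'rV[R]_m := \row_j p ord0 (widen_ord (leqnSn m) j).

Lemma chart_widen q j : chart q ord0 (widen_ord (leqnSn m) j) = q ord0 j.
Proof.
rewrite /Defs.chart mxE insubT /=; first exact: ltn_ord.
by move=> h; congr (q _ _); exact: val_inj.
Qed.

Lemma chart_max q : chart q ord0 (ord_max : 'I_n) = 1 - \sum_j q ord0 j.
Proof. by rewrite /Defs.chart mxE insubN// ltnn. Qed.

Lemma sum_chart q : \sum_(i < n) chart q ord0 i = 1.
Proof.
rewrite big_ord_recr /= chart_max; under eq_bigr do rewrite chart_widen.
by rewrite addrC subrK.
Qed.

Lemma chart_projK p : \sum_i p ord0 i = 1 -> chart (chart_proj p) = p.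
Proof.
move=> p1; apply/rowP => i; have [j ->|->] := unliftP ord_max i.
  have -> : lift ord_max j = widen_ord (leqnSn m) j.
    by apply/val_inj; rewrite /= /bump leqNgt ltn_ord.
  by rewrite chart_widen mxE.
rewrite chart_max -p1 big_ord_recr /= addrC.
by under [X in _ - X]eq_bigr do rewrite mxE; rewrite addrK.
Qed.

Lemma chartK q : chart_proj (chart q) = q.
Proof. by apply/rowP => j; rewrite mxE chart_widen. Qed.

Lemma chart_proj_line p p' (t : R) :
  chart_proj (p + t *: (p' - p)) = chart_proj p + t *: (chart_proj p' - chart_proj p).
Proof. by apply/rowP => j; rewrite !mxE. Qed.

Lemma ord_maxP (P : 'I_n -> Prop) :
  (forall j : 'I_m, P (widen_ord (leqnSn m) j)) -> P ord_max -> forall i, P i.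
Proof.
move=> Pw Pm i; have [j ->|->] := unliftP ord_max i; last exact: Pm.
have -> : lift ord_max j = widen_ord (leqnSn m) j.
  by apply/val_inj; rewrite /= /bump leqNgt ltn_ord.
exact: Pw.
Qed.

Lemma chart_simplex q : chart_dom m q -> simplex n (chart q).
Proof.
move=> [q01 q1]; split; last exact: sum_chart.
apply: ord_maxP => [j|]; first by rewrite chart_widen.
rewrite chart_max subr_gt0 q1 /= gtrBl.
rewrite (bigD1 (Ordinal m0))//= ltr_wpDr//; last by have /andP[] := q01 (Ordinal m0).
by apply: sumr_ge0 => j _; have /andP[/ltW] := q01 j.
Qed.

Lemma simplex_chart_dom p : simplex n p -> chart_dom m (chart_proj p).
Proof.
move=> [p01 p1]; split => [j|]; first by rewrite mxE.
rewrite -subr_gt0 -chart_max chart_projK//.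
by have /andP[] := p01 ord_max.
Qed.

Lemma chart_dom_open : open (@chart_dom R m).
Proof.
rewrite openE => q [q01 q1].
pose e := Num.min (\big[Num.min/1]_i Num.min (q ord0 i) (1 - q ord0 i))
   ((1 - \sum_i q ord0 i) / n%:R).
have e0 : 0 < e.
  rewrite lt_min divr_gt0// ?subr_gt0// andbT.
  apply: lt_bigmin => // i _; have /andP[h1 h2] := q01 i.
  by rewrite lt_min h1 subr_gt0.
apply/nbhs_ballP; exists e => // x; rewrite -ocube_ball => /(rV_norm_ltP _ e0) xe.
have xi i : `|x ord0 i - q ord0 i| < e by have := xe i; rewrite !mxE.
have ei i : e <= Num.min (q ord0 i) (1 - q ord0 i).
  by rewrite ge_min; apply/orP; left; exact: bigmin_le_cond.
split=> [i|].
  move: (xi i) (ei i); rewrite ltr_norml le_min => /andP[h1 h2] /andP[h3 h4].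
  by apply/andP; split; lra.
have en : e <= (1 - \sum_i q ord0 i) / n%:R by rewrite ge_min lexx orbT.
rewrite ler_pdivlMr ?ltr0Sn// in en.
have : \sum_i x ord0 i - \sum_i q ord0 i <= e * m%:R.
  rewrite -sumrB; apply: le_trans (ler_sum _ (_ : forall i, true -> _ <= e)) _.
    by move=> i _; apply: le_trans (ler_norm _) _; exact/ltW/xi.
  by rewrite sumr_const card_ord mulr_natr.
by move: en; rewrite -[n%:R]natr1; nra.
Qed.

Lemma chart_dom_unit_cube q : chart_dom m q -> ocube (const_mx (1 / 2)) (1 / 2) q.
Proof.
move=> [q01 _]; apply/rV_norm_ltP => // i; have := q01 i; rewrite !mxE ltr_norml.
by move=> /andP[? ?]; apply/andP; split; lra.
Qed.

(** A point of the closed simplex is approached from inside by moving towards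
    the barycenter. *)
Lemma csimplexE : csimplex n =
  [set p : 'rV[R]_n | (forall i, 0 <= p ord0 i) /\ \sum_i p ord0 i = 1].
Proof.
apply/seteqP; split => [p cp|p [p0 p1] B /nbhs_ballP[e /= e0 eB]].
  have near e : 0 < e -> exists p', simplex n p' /\ forall i, `|p' ord0 i - p ord0 i| < e.
    move=> e0; have [|p' [sp' pp']] := cp (ocube p e).
      by rewrite ocube_ball; exact: nbhsx_ballx.
    exists p'; split => // i; have := (rV_norm_ltP _ e0).1 pp' i.
    by rewrite !mxE.
  split=> [i|].
    rewrite leNgt; apply/negP => pi; have [|p' [[p'01 _] pp']] := near (- p ord0 i).
      by rewrite oppr_gt0.
    have /andP[h1 h2] := p'01 i; have := pp' i; rewrite ltr_norml => /andP[h3 h4]; lra.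
  apply/eqP; rewrite -subr_eq0 -normr_le0 leNgt; apply/negP => h.
  set A := `|_| in h; pose d := A / n.+1%:R.
  have d0 : 0 < d by rewrite divr_gt0.
  have [p' [[_ p'1] pp']] := near d d0.
  have AE : A = d * n%:R + d by rewrite -[X in _ + X]mulr1 -mulrDr natr1 divfK ?pnatr_eq0.
  suff : A <= d * n%:R by rewrite AE gerDl leNgt d0.
  have -> : A = `|\sum_i p ord0 i - \sum_i p' ord0 i| by rewrite p'1.
  rewrite -sumrB; apply: le_trans (ler_norm_sum _ _ _) _.
  apply: le_trans (ler_sum _ (_ : forall i, true -> _ <= d)) _.
    by move=> i _; rewrite distrC; exact/ltW/pp'.
  by rewrite sumr_const card_ord mulr_natr.
have pi1 i : p ord0 i <= 1.
  by rewrite -p1 (bigD1 i)//= lerDl sumr_ge0.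
have [t [t0 t1 te]] : exists t : R, [/\ 0 < t, t <= 1 / 2 & t <= e / 2].
  exists (Num.min (1 / 2) (e / 2)); rewrite lt_min !divr_gt0//.
  by split; rewrite // ge_min lexx ?orbT.
have n0 : 0 < n%:R^-1 :> R by rewrite invr_gt0 ltr0Sn.
have n1 : n%:R^-1 < 1 :> R by rewrite invf_lt1 ?ltr0Sn// ltr1n.
have mixP (a : R) : 0 <= a -> a <= 1 ->
    0 < (1 - t) * a + t * n%:R^-1 < 1 /\ `|(1 - t) * a + t * n%:R^-1 - a| <= t.
  move: n0 n1; generalize (n%:R^-1 : R) => c c0 c1 a0 a1.
  have h1 : 0 <= (1 - t) * a by apply: mulr_ge0 => //; lra.
  have h2 : 0 <= (1 - t) * (1 - a) by apply: mulr_ge0; lra.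
  have h3 : 0 < t * c by apply: mulr_gt0.
  have h4 : 0 < t * (1 - c) by apply: mulr_gt0 => //; lra.
  have h5 : 0 <= t * a by apply: mulr_ge0 => //; lra.
  have h6 : 0 <= t * (1 - a) by apply: mulr_ge0; lra.
  by split; [apply/andP; split; lra|rewrite ler_norml; apply/andP; split; lra].
pose p' := (1 - t) *: p + t *: (const_mx n%:R^-1).
exists p'; split.
  split=> [i|].
    by rewrite !mxE; have [h _] := mixP (p ord0 i) (p0 i) (pi1 i).
  under eq_bigr do rewrite !mxE.
  rewrite big_split /= -mulr_sumr p1 sumr_const card_ord.
  rewrite -[X in _ + X]mulr_natr -mulrA mulVf ?pnatr_eq0//.
  by rewrite !mulr1 subrK.
apply: eB; rewrite -ocube_ball; apply/rV_norm_ltP => // i; rewrite !mxE.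
have [_ h] := mixP (p ord0 i) (p0 i) (pi1 i).
by apply: le_lt_trans h _; lra.
Qed.

Lemma csimplex_compact : compact (@csimplex R n).
Proof.
apply: bounded_closed_compact; last exact: closed_closure.
exists 1; split; first exact: num_real.
move=> M M1 p; rewrite csimplexE => -[p0 p1].
apply: le_trans (ltW M1); apply/rV_norm_leP => // i; rewrite ger0_norm//.
by rewrite -p1 (bigD1 i)//= lerDl sumr_ge0.
Qed.

Lemma simplex_csimplex p : simplex n p -> csimplex n p.
Proof. exact: subset_closure. Qed.

Lemma csimplex_line p p' (t : R) : csimplex n p -> csimplex n p' -> 0 <= t <= 1 ->
  csimplex n (p + t *: (p' - p)).
Proof.
rewrite csimplexE => -[p0 p1] [p'0 p'1] /andP[t0 t1]; split=> [i|].
  by rewrite !mxE; have := p0 i; have := p'0 i; nra.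
under eq_bigr do rewrite !mxE.
by rewrite big_split /= -mulr_sumr sumrB p1 p'1 subrr mulr0 addr0.
Qed.

End simplex_chart.

(** * Continuity at a point, scalar products, and a determinant inequality *)

Section pointwise_continuity.
Context {R : realType} {T : topologicalType}.

Lemma continuous_at_sum (I : Type) (r : seq I) (F : I -> T -> R) c :
  (forall i, {for c, continuous (F i)}) ->
  {for c, continuous (fun x => \sum_(i <- r) F i x)}.
Proof.
move=> cF; elim: r => [|i r IH].
  rewrite (_ : (fun x => _) = cst 0); first exact: cst_continuous.
  by apply/funext => x; rewrite big_nil.
rewrite (_ : (fun x => _) = F i \+ (fun x => \sum_(i <- r) F i x)).
  exact: (continuousD (cF i) IH).
by apply/funext => x; rewrite big_cons.
Qed.

Lemma continuous_at_prod (I : Type) (r : seq I) (F : I -> T -> R) c :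
  (forall i, {for c, continuous (F i)}) ->
  {for c, continuous (fun x => \prod_(i <- r) F i x)}.
Proof.
move=> cF; elim: r => [|i r IH].
  rewrite (_ : (fun x => _) = cst 1); first exact: cst_continuous.
  by apply/funext => x; rewrite big_nil.
rewrite (_ : (fun x => _) = F i \* (fun x => \prod_(i <- r) F i x)).
  exact: (continuousM (cF i) IH).
by apply/funext => x; rewrite big_cons.
Qed.

Lemma continuous_at_det n (H : T -> 'M[R]_n) c :
  (forall i j, {for c, continuous (fun x => H x i j)}) ->
  {for c, continuous (fun x => \det (H x))}.
Proof.
move=> cH; rewrite /determinant; apply: continuous_at_sum => s.
have h1 (a : R) : {for c, continuous (cst a : T -> R)} by exact: cst_continuous.
have h2 : {for c, continuous (fun x => \prod_i H x i (s i))}.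
  by apply: continuous_at_prod => i.
exact: (continuousM (h1 _) h2).
Qed.

End pointwise_continuity.

Section dot_product.
Context {R : realType} {n : nat}.
Implicit Types (u v y : 'rV[R]_n).

Lemma dotrDl u v y : dotr (u + v) y = dotr u y + dotr v y.
Proof. by rewrite /dotr -big_split/=; apply: eq_bigr => i _; rewrite mxE mulrDl. Qed.

Lemma dotrZl (t : R) v y : dotr (t *: v) y = t * dotr v y.
Proof. by rewrite /dotr mulr_sumr; apply: eq_bigr => i _; rewrite mxE mulrA. Qed.

Lemma dotrBl u v y : dotr (u - v) y = dotr u y - dotr v y.
Proof. by rewrite dotrDl -scaleN1r dotrZl mulN1r. Qed.

Lemma dotrC u v : dotr u v = dotr v u.
Proof. by apply: eq_bigr => i _; rewrite mulrC. Qed.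

Lemma dotrZr (t : R) u v : dotr u (t *: v) = t * dotr u v.
Proof. by rewrite dotrC dotrZl dotrC. Qed.

Lemma dotrBr u v y : dotr u (v - y) = dotr u v - dotr u y.
Proof. by rewrite dotrC dotrBl ![dotr _ u]dotrC. Qed.

Lemma dotr_delta i y : dotr (delta_mx ord0 i) y = y ord0 i.
Proof.
rewrite /dotr (bigD1 i)//= mxE !eqxx mul1r big1 ?addr0// => j ji.
by rewrite mxE (negPf ji) andbF mul0r.
Qed.

Lemma dotr_le_norm u v : `|dotr u v| <= n%:R * `|u| * `|v|.
Proof.
apply: le_trans (ler_norm_sum _ _ _) _.
apply: le_trans (ler_sum _ (_ : forall i, true -> _ <= `|u| * `|v|)) _.
  by move=> i _; rewrite normrM ler_pM// rV_coord_norm.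
by rewrite sumr_const card_ord -mulrA mulr_natl.
Qed.

Lemma dotr_continuous v : continuous (dotr v).
Proof.
move=> c; apply: continuous_at_sum => i.
have h1 : {for c, continuous (cst (v ord0 i) : 'rV[R]_n -> R)} by exact: cst_continuous.
have h2 : {for c, continuous (fun x : 'rV[R]_n => x ord0 i)} by exact: coord_continuous.
exact: (continuousM h1 h2).
Qed.

End dot_product.

Section strict_lines.
Context {R : realType} {n : nat}.
Implicit Types (c v : 'rV[R]_n).

Lemma strict_gradient_line (g : 'rV[R]_n -> R) c w v e : strict_gradient g c w -> 0 < e ->
  exists2 r, 0 < r & forall t, `|t| <= r ->
    `|g (c + t *: v) - g c - t * \sum_i v ord0 i * w i| <= e * `|t|.
Proof.
move=> gw e0; have v0 : 0 < `|v| + 1 by rewrite ltr_wpDl.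
have [|r r0 rP] := gw (e / (`|v| + 1)); first by rewrite divr_gt0.
have [r' r'0 cr'] := ocube_line c v r0; exists r' => // t tr.
have := rP _ _ (cr' t tr) (ocube_center c r0); rewrite [c + _]addrC addrK.
rewrite (_ : \sum_i _ = t * \sum_i v ord0 i * w i); last first.
  by rewrite mulr_sumr; apply: eq_bigr => i _; rewrite mxE mulrA.
rewrite [t *: v + c]addrC => /le_trans; apply.
rewrite normrZ -mulrA ler_wpM2l ?(ltW e0)// mulrCA ler_piMr//.
by rewrite mulrC ler_pdivrMr// mul1r lerDl.
Qed.

Lemma strict_diff_line (T : 'rV[R]_n -> 'rV[R]_n) c L v e : strict_diff T c L -> 0 < e ->
  exists2 r, 0 < r & forall t, `|t| <= r ->
    `|T (c + t *: v) - T c - t *: (v *m L)| <= e * `|t|.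
Proof.
move=> TL e0; have v0 : 0 < `|v| + 1 by rewrite ltr_wpDl.
have [|r r0 rP] := TL (e / (`|v| + 1)); first by rewrite divr_gt0.
have [r' r'0 cr'] := ocube_line c v r0; exists r' => // t tr.
have := rP _ _ (cr' t tr) (ocube_center c r0); rewrite [c + _]addrC addrK -scalemxAl.
rewrite [t *: v + c]addrC => /le_trans; apply.
rewrite normrZ -mulrA ler_wpM2l ?(ltW e0)// mulrCA ler_piMr//.
by rewrite mulrC ler_pdivrMr// mul1r lerDl.
Qed.

Lemma strict_diff_components (T : 'rV[R]_n -> 'rV[R]_n) c (L : 'M[R]_n) :
  (forall j, strict_gradient (fun x => T x ord0 j) c (fun i => L i j)) ->
  strict_diff T c L.
Proof.
move=> TL d d0.
have [r rP] := choice (fun j => let: ex_intro2 r r0 h := TL j d d0 in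
  ex_intro (fun r => 0 < r /\ forall u v, ocube c r u -> ocube c r v ->
    `|T u ord0 j - T v ord0 j - \sum_i (u - v) ord0 i * L i j| <= d * `|u - v|) r (conj r0 h)).
exists (\big[Num.min/1]_j r j).
  by apply: lt_bigmin => // j _; have [] := rP j.
move=> u v cu cv; apply/rV_norm_leP => [|j]; first by rewrite mulr_ge0// ltW.
have [_ h] := rP j; rewrite !mxE; apply: h.
  by apply: lt_le_trans cu _; exact: bigmin_le_cond.
by apply: lt_le_trans cv _; exact: bigmin_le_cond.
Qed.

End strict_lines.

(** The form v A v^T need not be symmetric.  Along the segment from A to the
    identity the matrices have positive definite form, so the determinant does
    not vanish before A; it is 1 at the identity, hence nonnegative at A. *)
Lemma det_ge0 (R : realType) n (A : 'M[R]_n) :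
  (forall v, 0 <= dotr v (v *m A)) -> 0 <= \det A.
Proof.
move=> A0; rewrite leNgt; apply/negP => detA.
pose M : 'M[{poly R}]_n := \matrix_(i, j) ((A i j)%:P * (1 - 'X) + (i == j)%:R *: 'X).
have ME t : (\det M).[t] = \det ((1 - t) *: A + t%:M).
  rewrite -/(horner_eval t _) -det_map_mx; congr determinant; apply/matrixP => i j.
  rewrite /M !mxE /= /horner_eval hornerD hornerM hornerC hornerZ hornerD hornerN.
  by rewrite hornerX hornerC mulrC mulr_natl.
have [||t /andP[t0 t1] /rootP] := @poly_ivt R (\det M) 0 1.
- exact: ler01.
- rewrite !ME subr0 scale1r subrr scale0r add0r det1 ler01 andbT.
  by rewrite (_ : 0%:M = 0) ?addr0 ?ltW// raddf0.
rewrite ME => /eqP/det0P[v v0].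
have [t00|tN0] := eqVneq t 0.
  move: detA; rewrite t00 subr0 scale1r raddf0 addr0 => detA vA.
  have /det0P/eqP dA : exists2 v : 'rV_n, v != 0 & v *m A = 0 by exists v.
  by rewrite dA ltxx in detA.
have {}t0 : 0 < t by rewrite lt_neqAle eq_sym tN0.
move=> /(congr1 (dotr v)); rewrite mulmxDr -scalemxAr mul_mx_scalar dotrC dotrDl !dotrZl.
rewrite [X in _ * X + _]dotrC [RHS](_ : _ = 0); last first.
  by rewrite /dotr big1// => i _; rewrite mxE mulr0.
have vv : 0 < dotr v v.
  have vi i : 0 <= v ord0 i * v ord0 i by rewrite -expr2 sqr_ge0.
  rewrite lt_neqAle sumr_ge0// andbT eq_sym; apply: contra_neq v0 => vv.
  apply/rowP => i; rewrite mxE; apply/eqP; rewrite -[_ == 0]orbb -mulf_eq0.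
  by apply/eqP; exact: (psumr_eq0P (fun j _ => vi j) vv).
move=> h; have : 0 < (1 - t) * dotr v (v *m A) + t * dotr v v.
  by rewrite ltr_wpDl// ?mulr_ge0 ?subr_ge0// mulr_gt0.
by rewrite h ltxx.
Qed.

(** * Concave functions on the simplex *)

Section concave_on_simplex.
Context {R : realType} (m : nat).
Hypothesis m0 : (0 < m)%N.
Notation n := m.+1.
Notation chart := (@chart R m.+1).
Variable psi : 'rV[R]_n -> R.
Hypothesis hpsi : classC psi.
Implicit Types (p x : 'rV[R]_n) (q y v : 'rV[R]_m).
Let f : 'rV[R]_m -> R := in_chart psi.
Let D := @chart_dom R m.

Lemma psi_concave p p' t : csimplex n p -> csimplex n p' -> 0 <= t <= 1 ->
  psi p + t * (psi p' - psi p) <= psi (p + t *: (p' - p)).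
Proof.
move=> cp cp' /andP[t0 t1]; have [_ _ /(_ (Itv01 t0 t1) p' p)] := hpsi.
rewrite !inE => /(_ cp' cp) h.
have {}h : - psi (t *: p' + (1 - t) *: p) <= t * - psi p' + (1 - t) * - psi p by exact: h.
rewrite (_ : p + t *: (p' - p) = t *: p' + (1 - t) *: p); first lra.
by apply/rowP => i; rewrite !mxE; ring.
Qed.

Lemma maximizer_exists (s : R) y : exists p, csimplex n p /\ forall p', csimplex n p' ->
  s * psi p' - dotr (chart_proj p') y <= s * psi p - dotr (chart_proj p) y.
Proof.
have [||p /set_mem cp pmax] := @EVT_max_rV R n
    (fun p => s * psi p - dotr (chart_proj p) y) (csimplex n) _ (csimplex_compact m0).
- exists (delta_mx ord0 ord0); rewrite csimplexE//; split=> [i|].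
    by rewrite mxE ler0n.
  by rewrite (bigD1 ord0)//= big1 => [|i /negPf i0]; rewrite mxE ?eqxx ?addr0// i0.
- have [_ cpsi _] := hpsi; move=> x.
  have h1 : {for x, continuous (cst s : subspace (csimplex n) -> R)} by exact: cst_continuous.
  apply: (@continuousB _ _ _ (fun p : subspace (csimplex n) => s * psi p)
    (fun p : subspace (csimplex n) => dotr (chart_proj p) y)).
    exact: (continuousM h1 (cpsi x)).
  apply: continuous_subspaceT => z; apply: continuous_at_sum => i.
  have h2 : {for z, continuous (cst (y ord0 i) : 'rV[R]_n -> R)} by exact: cst_continuous.
  have h3 : {for z, continuous (fun p : 'rV[R]_n => chart_proj p ord0 i)}.
    rewrite (_ : (fun p => _) = fun p : 'rV[R]_n => p ord0 (widen_ord (leqnSn m) i)).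
      exact: coord_continuous.
    by apply/funext => p; rewrite mxE.
  exact: (continuousM h3 h2).
by exists p; split=> // p' cp'; apply: pmax; rewrite inE.
Qed.

Definition maximizer s y := projT1 (cid (maximizer_exists s y)).

(** The Legendre transform of s psi, in the chart. *)
Definition legendre s y := s * psi (maximizer s y) - dotr (chart_proj (maximizer s y)) y.

Lemma maximizerP s y : csimplex n (maximizer s y).
Proof. by rewrite /maximizer; case: cid => p /= []. Qed.

Lemma legendre_ge s y p : csimplex n p -> s * psi p - dotr (chart_proj p) y <= legendre s y.
Proof. by rewrite /legendre /maximizer; case: cid => p' /= [_]; exact. Qed.

(** A supremum of affine functions is lower semicontinuous. *)
Lemma legendre_measurable s : measurable_fun setT (legendre s).
Proof.
apply: measurable_fun_lsc => a; rewrite setTI openE => y ay.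
set p := maximizer s y; have cp := @maximizerP s y.
have := @dotr_continuous R m (chart_proj p) y.
move=> /(_ [set t | t < s * psi p - a]) h.
have {h} : nbhs y [set z | dotr (chart_proj p) z < s * psi p - a].
  apply: h; apply: open_nbhs_nbhs; split; first exact: open_lt.
  by move: ay; rewrite /legendre -/p /=; lra.
apply: filterS => z /= h; apply: lt_le_trans (@legendre_ge s z p cp); lra.
Qed.

Lemma legendre_le s t y : s <= t -> legendre s y <= legendre t y.
Proof.
move=> st; apply: le_trans (@legendre_ge t y _ (@maximizerP s y)).
have [psi0 _ _] := hpsi.
by rewrite {1}/legendre lerD2r ler_wpM2r// psi0//; exact: maximizerP.
Qed.

Hypothesis hC2 : C2on D f.

Definition grad q : 'rV[R]_m := \row_j partial j f q.

Let oD : open D := @chart_dom_open R m.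

Lemma grad_line q v e : D q -> 0 < e -> exists2 r, 0 < r & forall t, `|t| <= r ->
  D (q + t *: v) /\ `|f (q + t *: v) - f q - t * dotr v (grad q)| <= e * `|t|.
Proof.
move=> Dq e0; have sg := C1on_strict_gradient oD Dq hC2.1.
have [r1 r10 r1P] := strict_gradient_line v sg e0.
have [r2 r20 r2P] := open_ocube oD Dq.
have [r3 r30 r3P] := ocube_line q v r20.
exists (Num.min r1 r3); first by rewrite lt_min r10.
move=> t; rewrite le_min => /andP[t1 t3]; split; first exact/r2P/r3P.
have := r1P t t1; congr (`|_ - t * _| <= _).
by apply: eq_bigr => i _; rewrite mxE.
Qed.

Lemma grad_strict_diff q : D q -> strict_diff grad q (hessian f q).
Proof.
move=> Dq; apply: strict_diff_components => j.
have -> : (fun z : 'rV_m => grad z ord0 j) = partial j f by apply/funext => z; rewrite mxE.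
have -> : (fun i => hessian f q i j) = (fun i => partial i (partial j f) q).
  by apply/funext => i; rewrite mxE.
exact: C1on_strict_gradient oD Dq (hC2.2 j).
Qed.

(** By concavity, psi(p) - f(q) is at most the difference quotient of f from q
    towards p, which tends to the derivative.  The boundary points p are
    included: this makes q a maximizer over the whole closed simplex. *)
Lemma tangent q p : D q -> csimplex n p ->
  psi p - dotr (chart_proj p) (grad q) <= f q - dotr q (grad q).
Proof.
move=> Dq cp; have cq := simplex_csimplex (chart_simplex m0 Dq).
suff : psi p - f q <= dotr (chart_proj p - q) (grad q) by rewrite dotrBl; lra.
apply/ler_addgt0Pr => e e0.
have [r r0 rP] := grad_line (chart_proj p - q) Dq e0.
pose t := Num.min r 1; have t0 : 0 < t by rewrite lt_min r0 ltr01.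
have [|_] := rP t; first by rewrite gtr0_norm// ge_min lexx.
have pE : chart (q + t *: (chart_proj p - q)) = chart q + t *: (p - chart q).
  have -> : q + t *: (chart_proj p - q) = chart_proj (chart q + t *: (p - chart q)).
    by rewrite chart_proj_line chartK.
  rewrite chart_projK//.
  have t01 : 0 <= t <= 1 by rewrite ltW// ge_min lexx orbT.
  by have := csimplex_line m0 cq cp t01; rewrite csimplexE// => -[].
have := psi_concave cq cp (_ : 0 <= t <= 1).
rewrite ltW// ge_min lexx orbT -pE => /(_ isT); rewrite -/(in_chart psi _) -/(in_chart psi _) -/f.
rewrite (gtr0_norm t0) => h1; rewrite ler_norml => /andP[_ h2].
rewrite -(ler_pM2l t0) mulrDr; move: h1; rewrite -/(in_chart psi q) -/f => h1; lra.
Qed.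

(** Fermat's rule. *)
Lemma maximizer_grad q y : D q ->
  (forall q', D q' -> f q' - dotr q' y <= f q - dotr q y) -> grad q = y.
Proof.
move=> Dq qmax; apply/rowP => j; apply/eqP; rewrite -subr_eq0 -normr_le0.
apply/ler_addgt0Pr => e e0; rewrite add0r.
have [r r0 rP] := grad_line (delta_mx ord0 j) Dq e0.
have bound t : `|t| <= r -> t * (grad q ord0 j - y ord0 j) <= e * `|t|.
  move=> /rP[Dt]; rewrite dotr_delta ler_norml => /andP[h _].
  by have := qmax _ Dt; rewrite dotrDl dotrZl dotr_delta; lra.
have := bound r; rewrite gtr0_norm// => /(_ (lexx _)).
have := bound (- r); rewrite normrN gtr0_norm// => /(_ (lexx _)).
rewrite mulNr -mulrN ![r * _]mulrC !ler_pM2r// => h1 h2.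
by rewrite ler_norml; apply/andP; split; lra.
Qed.

Lemma legendre_grad s q : D q -> s * f q - dotr q (grad q) <= legendre s (grad q).
Proof.
move=> Dq; rewrite -{2}(chartK q).
exact: (legendre_ge _ _ (simplex_csimplex (chart_simplex m0 Dq))).
Qed.

Lemma legendre1_grad q : D q -> legendre 1 (grad q) = f q - dotr q (grad q).
Proof.
move=> Dq; apply/eqP; rewrite eq_le; apply/andP; split.
  rewrite /legendre mul1r; exact: (tangent Dq (@maximizerP 1 (grad q))).
by have := legendre_grad 1 Dq; rewrite mul1r.
Qed.

(** Two points with the same gradient y both maximize f - <., y>, so by
    concavity the whole segment between them does, and the gradient equals y
    along it.  Its direction is then in the kernel of the Hessian at q. *)
Lemma grad_injective q q' : D q -> D q' -> \det (hessian f q) != 0 ->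
  grad q = grad q' -> q = q'.
Proof.
move=> Dq Dq' dq gq; pose v := q' - q.
have cq := simplex_csimplex (chart_simplex m0 Dq).
have cq' := simplex_csimplex (chart_simplex m0 Dq').
have eq_val : f q - dotr q (grad q) = f q' - dotr q' (grad q).
  by rewrite -legendre1_grad// gq legendre1_grad.
have vH : v *m hessian f q = 0.
  apply/eqP; rewrite -normr_le0; apply/ler_addgt0Pr => e e0; rewrite add0r.
  have [r r0 rP] := strict_diff_line v (grad_strict_diff Dq) e0.
  have [r' r'0 r'P] := grad_line v Dq ltr01.
  pose t := Num.min (Num.min r r') 1; have t0 : 0 < t by rewrite !lt_min r0 r'0 ltr01.
  have t1 : 0 <= t <= 1 by rewrite (ltW t0) ge_min lexx orbT.
  have tr : `|t| <= r by rewrite gtr0_norm// !ge_min lexx.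
  have [|Dt _] := r'P t; first by rewrite gtr0_norm// !ge_min lexx orbT.
  have vE : q + t *: v = chart_proj (chart q + t *: (chart q' - chart q)).
    by rewrite chart_proj_line !chartK.
  have gt : grad (q + t *: v) = grad q.
    apply: maximizer_grad => // z Dz.
    have h1 : f z - dotr z (grad q) <= f q - dotr q (grad q).
      by have := tangent Dq (simplex_csimplex (chart_simplex m0 Dz)); rewrite chartK.
    apply: (le_trans h1); rewrite dotrDl dotrZl dotrBl.
    have := psi_concave cq cq' t1.
    rewrite (_ : psi (_ + _) = f (q + t *: v)); last first.
      rewrite /f /in_chart vE chart_projK//.
      by have := csimplex_line m0 cq cq' t1; rewrite csimplexE// => -[].
    rewrite -/(in_chart psi q) -/(in_chart psi q') -/f => h2.
    have : f q' - f q = dotr q' (grad q) - dotr q (grad q) by lra.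
    by move=> h3; rewrite h3 in h2; lra.
  have := rP t tr; rewrite gt subrr sub0r normrN normrZ mulrC ler_pM2r//.
  by rewrite normr_gt0 gt_eqF.
have uH : hessian f q \in unitmx by rewrite unitmxE unitfE.
have : v = 0 by rewrite -(mulmxK uH v) vH mul0mx.
by move/eqP; rewrite subr_eq0 => /eqP.
Qed.

(** Adding the tangent inequalities at two points shows that the gradient is
    monotone: <u - q, grad u - grad q> <= 0.  Let u tend to q along v. *)
Lemma hessian_nonpos q v : D q -> dotr v (v *m hessian f q) <= 0.
Proof.
move=> Dq; apply/ler_addgt0Pr => e e0; rewrite add0r.
pose d := e / (m%:R * `|v| + 1).
have K0 : 0 < m%:R * `|v| + 1 by rewrite ltr_wpDl// mulr_ge0.
have d0 : 0 < d by rewrite divr_gt0.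
have [r r0 rP] := strict_diff_line v (grad_strict_diff Dq) d0.
have [r' r'0 r'P] := grad_line v Dq ltr01.
pose t := Num.min r r'; have t0 : 0 < t by rewrite lt_min r0.
have tr : `|t| <= r by rewrite gtr0_norm// ge_min lexx.
have [|Dt _] := r'P t; first by rewrite gtr0_norm// ge_min lexx orbT.
have := rP t tr; set E := _ - _ - _ => hE.
have mono : dotr v (grad (q + t *: v) - grad q) <= 0.
  have h1 := tangent Dq (simplex_csimplex (chart_simplex m0 Dt)).
  have h2 := tangent Dt (simplex_csimplex (chart_simplex m0 Dq)).
  rewrite !chartK -!/(in_chart psi _) -!/f in h1 h2.
  rewrite dotrBr -(pmulr_rle0 _ t0) mulrBr.
  rewrite !dotrDl !dotrZl in h1 h2.
  by move: h1 h2; rewrite /f /in_chart; lra.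
have hv : t * dotr v (v *m hessian f q) = dotr v (grad (q + t *: v) - grad q) - dotr v E.
  by rewrite /E [X in _ = _ - X]dotrBr dotrZr opprB addrC subrK.
have : t * dotr v (v *m hessian f q) <= t * e.
  rewrite hv; apply: (@le_trans _ _ (0 + `|dotr v E|)).
    by rewrite lerD//; apply: le_trans (ler_norm _) _; rewrite normrN.
  rewrite add0r; apply: le_trans (dotr_le_norm _ _) _.
  apply: (@le_trans _ _ (m%:R * `|v| * (d * t))).
    by rewrite ler_wpM2l ?mulr_ge0//; move: hE; rewrite (gtr0_norm t0).
  rewrite mulrA mulrC ler_wpM2l ?(ltW t0)// /d mulrCA ler_piMr ?(ltW e0)//.
  by rewrite ler_pdivrMr// mul1r lerDl.
by rewrite ler_pM2l.
Qed.

Lemma det_hessian q : D q -> \det (- hessian f q) = `|\det (hessian f q)|.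
Proof.
move=> Dq; rewrite -[LHS]ger0_norm.
  by rewrite -scaleN1r detZ normrM normrX normrN1 expr1n mul1r.
apply: det_ge0 => v; rewrite mulmxN -scaleN1r dotrZr mulN1r oppr_ge0.
exact: hessian_nonpos.
Qed.

Lemma det_hessian_continuous q : D q ->
  {for q, continuous (fun z => `|\det (hessian f z)|)}.
Proof.
move=> Dq; suff h : {for q, continuous (fun z => \det (hessian f z))} by exact: (cvg_norm h).
apply: continuous_at_det => i j.
have -> : (fun z : 'rV_m => hessian f z i j) = partial i (partial j f).
  by apply/funext => z; rewrite mxE.
by have [_] := hC2.2 j i; apply.
Qed.

Lemma in_chart_continuous q : D q -> {for q, continuous f}.
Proof.
move=> Dq; apply/(@cvgrPdist_le _ _ _ (nbhs q) (nbhs_filter q)) => e e0.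
have [r r0 rP] := C1on_strict_gradient oD Dq hC2.1 ltr01.
pose C := \sum_i `|partial i f q| + 1.
have C0 : 0 < C by rewrite ltr_wpDl// sumr_ge0.
apply/nbhs_ballP; exists (Num.min r (e / (C + 1))).
  by rewrite /= lt_min r0 divr_gt0// addr_gt0.
move=> z; rewrite -ocube_ball /ocube /= lt_min => /andP[zr ze].
have := rP z q zr; rewrite /ocube /= subrr normr0 => /(_ r0) h.
rewrite distrC; set S := \sum_i _ in h.
have hS : `|S| <= C * `|z - q|.
  apply: le_trans (ler_norm_sum _ _ _) _; rewrite /C mulrDl mulr_suml mul1r.
  apply: ler_wpDr => //; apply: ler_sum => i _; rewrite normrM mulrC ler_wpM2l//.
  exact: rV_coord_norm.
rewrite -(subrK S (f z - f q)); apply: le_trans (ler_normD _ _) _.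
apply: (@le_trans _ _ ((C + 1) * `|z - q|)); first by rewrite mulrDl addrC lerD.
by rewrite mulrC -(ler_pdivlMr _ _ (addr_gt0 C0 ltr01)) ltW.
Qed.

End concave_on_simplex.

(** * The volume of the region by slicing *)

Section region_volume.
Context {R : realType} (m : nat).
Hypothesis m0 : (0 < m)%N.
Notation n := m.+1.
Variable psi : 'rV[R]_n -> R.
Hypothesis hpsi : classC psi.
Implicit Types (p x : 'rV[R]_n) (q y v : 'rV[R]_m).
Notation L := (legendre m0 hpsi).
Notation leb := lebesgue_rV.

Lemma Rhat_open (phi : 'rV[R]_n -> R) : open (Rhat phi).
Proof.
apply: bigcup_open => p _; rewrite openE => x [x0 px].
have h1 : \forall z \near x, posorthant n z.
  apply: (@filter_forall _ _ (fun i z => 0 < z ord0 i) (nbhs x) _) => i.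
  have /(_ [set t | 0 < t]) := @coord_continuous R 1 n ord0 i x; apply.
  by apply: open_nbhs_nbhs; split; [exact: open_gt|exact: x0].
have h2 : \forall z \near x, dotr p z < phi p.
  have /(_ [set t | t < phi p]) := @dotr_continuous R n p x; apply.
  by apply: open_nbhs_nbhs; split; [exact: open_lt|exact: px].
exact: filterI h1 h2.
Qed.

Lemma simplex_mix p b t : csimplex n p -> simplex n b -> 0 < t <= 1 ->
  simplex n (p + t *: (b - p)).
Proof.
rewrite csimplexE// => -[p0 p1] [b01 b1] /andP[t0 t1]; split=> [i|].
  have pi1 : p ord0 i <= 1 by rewrite -p1 (bigD1 i)//= lerDl sumr_ge0.
  rewrite !mxE; have /andP[h1 h2] := b01 i; have h3 := p0 i.
  have h4 : 0 < t * b ord0 i by apply: mulr_gt0.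
  have h5 : 0 < t * (1 - b ord0 i) by apply: mulr_gt0; lra.
  have h6 : 0 <= (1 - t) * p ord0 i by apply: mulr_ge0; lra.
  have h7 : 0 <= (1 - t) * (1 - p ord0 i) by apply: mulr_ge0; lra.
  by apply/andP; split; lra.
under eq_bigr do rewrite !mxE.
by rewrite big_split /= -mulr_sumr sumrB p1 b1 subrr mulr0 addr0.
Qed.

(** Maps (z, y) to (z + y_1, ..., z + y_m, z). *)
Definition slant : 'M[R]_n :=
  \matrix_(i, j) if i == ord0 then 1 else (i == j.+1 :> nat)%:R.

Lemma slant_widen (u : measurableTypeR R * 'rV[R]_m) j :
  (rV_cons u *m slant) ord0 (widen_ord (leqnSn m) j) = u.1 + u.2 ord0 j.
Proof.
rewrite mxE big_ord_recl /= rV_cons0 !mxE /= mulr1; congr (_ + _).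
rewrite (bigD1 j)//= rV_consS !mxE /= /bump /= add1n eqxx mulr1 big1 ?addr0// => i ij.
by rewrite !mxE /= /bump /= add1n eqSS (negPf (_ : val i != val j))// mulr0.
Qed.

Lemma slant_max (u : measurableTypeR R * 'rV[R]_m) :
  (rV_cons u *m slant) ord0 ord_max = u.1.
Proof.
rewrite mxE big_ord_recl /= rV_cons0 !mxE /= mulr1 big1 ?addr0// => i _.
by rewrite !mxE /= /bump /= add1n eqSS ltn_eqF// mulr0.
Qed.

Lemma norm_det_slant : `|\det slant| = 1.
Proof.
rewrite (expand_det_col _ ord_max) (bigD1 ord0)//= big1 ?addr0 => [|i i0].
  rewrite mxE /= mul1r /cofactor normrM normrX normrN1 expr1n mul1r.
  rewrite (_ : row' _ _ = 1%:M) ?det1 ?normr1//; apply/matrixP => i j.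
  rewrite !mxE /= /bump /= [(m <= j)%N]leqNgt ltn_ord /=.
  by rewrite add0n add1n eqSS.
rewrite mxE (negPf i0) (_ : (_ == _) = false) ?mul0r//.
by apply/negbTE; rewrite ltn_eqF// ltn_ord.
Qed.

Lemma dotr_slant p (u : measurableTypeR R * 'rV[R]_m) : \sum_i p ord0 i = 1 ->
  dotr p (rV_cons u *m slant) = u.1 + dotr (chart_proj p) u.2.
Proof.
move=> p1; rewrite /dotr big_ord_recr /= slant_max.
under eq_bigr do rewrite slant_widen mulrDr.
rewrite big_split /= -mulr_suml addrAC -mulrDl; congr (_ + _).
  by rewrite -{2}[u.1]mul1r -p1 big_ord_recr.
by apply: eq_bigr => j _; rewrite mxE.
Qed.

Lemma dotr_gt0 p x : csimplex n p -> posorthant n x -> 0 < dotr p x.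
Proof.
rewrite csimplexE// => -[p0 p1] x0.
have px0 i : 0 <= p ord0 i * x ord0 i by rewrite mulr_ge0// ltW// x0.
rewrite lt_neqAle sumr_ge0// andbT eq_sym; apply/eqP => px.
have : \sum_i p ord0 i = 0.
  rewrite big1// => i _; have /eqP := psumr_eq0P (fun j _ => px0 j) px (i := i) isT.
  by rewrite mulf_eq0 (gt_eqF (x0 i)) orbF => /eqP.
by rewrite p1 => /eqP; rewrite oner_eq0.
Qed.

(** The lower bound is positivity of x, by testing the vertices of the simplex.
    For the upper bound, a maximizer may lie on the boundary of the simplex; it
    is moved slightly inside, which by concavity costs little. *)
Lemma Rhat_slice s y z : 0 <= s ->
  Rhat (fun p => s * psi p) (rV_cons (z : measurableTypeR R, y) *m slant) <->
  L 0 y < z < L s y.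
Proof.
move=> s0; set x := _ *m _.
have dotx p : csimplex n p -> dotr p x = z + dotr (chart_proj p) y.
  by rewrite csimplexE// => -[_ p1]; rewrite /x dotr_slant.
split=> [[p sp [x0 px]]|/andP[z0 zs]].
  have cp := simplex_csimplex sp; apply/andP; split.
    have c0 := @maximizerP _ _ m0 psi hpsi 0 y.
    by have := dotr_gt0 c0 x0; rewrite (dotx _ c0) /legendre mul0r; lra.
  rewrite dotx// in px.
  by apply: lt_le_trans (@legendre_ge _ _ m0 psi hpsi s y p cp); lra.
have x0 : posorthant n x.
  move=> i; have ci : csimplex n (delta_mx ord0 i : 'rV[R]_n).
    rewrite csimplexE//; split=> [j|]; first by rewrite mxE ler0n.
    by rewrite (bigD1 i)//= big1 => [|j /negPf ji]; rewrite mxE ?eqxx ?addr0// ji andbF.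
  rewrite -dotr_delta dotx//.
  by have := @legendre_ge _ _ m0 psi hpsi 0 y _ ci; rewrite mul0r; lra.
pose p := maximizer m0 hpsi s y; have cp : csimplex n p := @maximizerP _ _ m0 psi hpsi s y.
(* b is any interior point *)
have [b [sb _]] := cp setT filterT.
pose h p := s * psi p - dotr (chart_proj p) y.
have hp : z < h p by [].
have K0 : 0 < `|h b - h p| + 1 by rewrite ltr_wpDl.
have [t [t0 t1 tK]] : exists t, [/\ 0 < t, t <= 1 & t * (`|h b - h p| + 1) <= h p - z].
  exists (Num.min 1 ((h p - z) / (`|h b - h p| + 1))); split.
  - by rewrite lt_min ltr01 divr_gt0// subr_gt0.
  - by rewrite ge_min lexx.
  - by rewrite -ler_pdivlMr// ge_min lexx orbT.
have st : simplex n (p + t *: (b - p)) by apply: simplex_mix => //; rewrite t0.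
exists (p + t *: (b - p)) => //; split => //.
rewrite dotx; last exact: simplex_csimplex.
have hc : h p + t * (h b - h p) <= h (p + t *: (b - p)).
  rewrite /h chart_proj_line dotrDl dotrZl dotrBl.
  have := @psi_concave _ _ psi hpsi p b t cp (simplex_csimplex sb).
  rewrite (ltW t0) t1 => /(_ isT) /(ler_wpM2l s0).
  have key A B C E G : s * (A + t * (B - A)) <= s * C ->
      s * A - E + t * (s * B - G - (s * A - E)) <= s * C - (E + t * (G - E)).
    move=> ABC; rewrite (_ : _ + t * _ = s * (A + t * (B - A)) - (E + t * (G - E))); last by ring.
    by rewrite lerD2r.
  exact: key.
suff : z < h (p + t *: (b - p)) by rewrite /h ltrBrDr.
apply: lt_le_trans hc; move: tK; rewrite mulrDr mulr1.
have : - (t * `|h b - h p|) <= t * (h b - h p).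
  by rewrite -mulrN ler_wpM2l ?(ltW t0)// lerNl -normrN ler_norm.
move: (h p) (t * (h b - h p)) (t * `|_|) => A B C h1 h2; lra.
Qed.

Lemma volume_Rhat s : 0 <= s ->
  leb n (Rhat (fun p => s * psi p)) =
  (\int[leb m]_y (L s y - L 0 y)%:E)%E.
Proof.
move=> s0; have mR := open_measurable_rV (@Rhat_open (fun p => s * psi p)).
have dN0 : \det slant != 0 by rewrite -normr_eq0 norm_det_slant oner_neq0.
have [mM ME] := lebesgue_rV_mulmx dN0.
rewrite -(ME _ mR) norm_det_slant mul1e.
rewrite /= /lebesgue_rV_step /pushforward /= product_measure21; last first.
  apply: measurable_preimageT; first exact: measurable_rV_cons.
  exact: measurable_preimageT.
rewrite /product_measure2 /=; apply: eq_integral => y _.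
transitivity (lebesgue_measure (`]L 0 y, L s y[%classic : set R)).
  congr lebesgue_measure; apply/seteqP; split => z;
    rewrite /ysection /= inE /= ?in_itv /=.
    by move/(Rhat_slice y z s0).
  by move=> h; apply/(Rhat_slice y z s0).
rewrite lebesgue_measure_itv/= lte_fin.
have := legendre_le m0 hpsi y s0; rewrite le_eqVlt => /orP[/eqP ->|-> //].
by rewrite ltxx subrr.
Qed.

Lemma Rhat_scale s : 0 < s ->
  leb n (Rhat (fun p => s * psi p)) = ((s ^+ n)%:E * leb n (Rhat psi))%E.
Proof.
move=> s0; have mR := open_measurable_rV (@Rhat_open psi).
have dE : \det (s^-1%:M : 'M[R]_n) = s ^- n by rewrite det_scalar exprVn.
have d0 : \det (s^-1%:M : 'M[R]_n) != 0 by rewrite dE invr_eq0 expf_neq0// gt_eqF.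
have [_ /(_ _ mR) <-] := lebesgue_rV_mulmx d0.
rewrite dE muleA -EFinM ger0_norm ?invr_ge0 ?exprn_ge0 ?(ltW s0)//.
rewrite divff ?expf_neq0 ?gt_eqF// mul1e; congr (leb n _).
have s10 : 0 < s^-1 by rewrite invr_gt0.
apply/seteqP; split => x /=.
  move=> [p sp [x0 px]]; exists p => //; rewrite mul_mx_scalar; split.
    by move=> i; rewrite mxE mulr_gt0.
  by rewrite dotrZr mulrC ltr_pdivrMr// mulrC.
move=> [p sp]; rewrite mul_mx_scalar => -[x0 px]; exists p => //; split.
  by move=> i; have := x0 i; rewrite mxE pmulr_rgt0.
by move: px; rewrite dotrZr mulrC ltr_pdivrMr// mulrC.
Qed.

End region_volume.

(** * Comparison of the dilates *)

Section volume_bounds.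
Context {R : realType} (m : nat).
Hypothesis m0 : (0 < m)%N.
Notation n := m.+1.
Variable psi : 'rV[R]_n -> R.
Hypothesis hpsi : classC psi.
Implicit Types (p x : 'rV[R]_n) (q y v : 'rV[R]_m).
Let f : 'rV[R]_m -> R := in_chart psi.
Let D := @chart_dom R m.
Hypothesis hC2 : C2on D f.
Hypothesis hbd : forall p, bsimplex n p -> psi p = 0.
Notation L := (legendre m0 hpsi).
Notation leb := lebesgue_rV.
Notation G := (grad psi).
Notation beta := (\int[leb m]_(q in D) (f q * `|\det (hessian f q)|)%:E)%E.

Let f_ge0 q : D q -> 0 <= f q.
Proof.
move=> Dq; have [psi0 _ _] := hpsi.
exact: psi0 (simplex_csimplex (chart_simplex m0 Dq)).
Qed.

Let half_gt0 : 0 < 1 / 2 :> R. Proof. by rewrite divr_gt0. Qed.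

(** The difference quotient is at most f(q) at y = grad f(q), by definition of
    L(s, y) as a maximum.  At any other y the maximizer for s = 1 lies on the
    boundary, where psi = 0, and L(s, y) = L(1, y). *)
Lemma legendre_upper s : 0 <= s < 1 ->
  (\int[leb m]_y (L 1 y - L s y)%:E <= (1 - s)%:E * beta)%E.
Proof.
move=> /andP[s0 s1]; have s1' : 0 < 1 - s by rewrite subr_gt0.
have [psi0 _ _] := hpsi.
pose g y := (L 1 y - L s y) / (1 - s).
have gm : measurable_fun setT g.
  apply: measurable_funM => //; apply: measurable_funB; exact: legendre_measurable.
have g0 y : 0 <= g y.
  rewrite divr_ge0 ?(ltW s1')// subr_ge0.
  by apply: legendre_le; exact: ltW.
have gf q : D q -> g (G q) <= f q.
  move=> Dq; rewrite /g ler_pdivrMr// legendre1_grad//.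
  by have := legendre_grad m0 hpsi s Dq; rewrite -/f; lra.
have gD y : ~ (G @` D) y -> g y = 0.
  move=> ny; apply/eqP; rewrite eq_le g0 andbT /g ler_pdivrMr// mul0r subr_le0.
  pose p := maximizer m0 hpsi 1 y; have cp : csimplex n p := @maximizerP _ _ m0 psi hpsi 1 y.
  have pmax p' : csimplex n p' -> psi p' - dotr (chart_proj p') y <= psi p - dotr (chart_proj p) y.
    by move=> cp'; have := @legendre_ge _ _ m0 psi hpsi 1 y p' cp'; rewrite /legendre !mul1r.
  have psip : psi p = 0.
    apply: hbd; split => // sp; apply: ny; exists (chart_proj p).
      exact: simplex_chart_dom.
    apply: (maximizer_grad hC2); first exact: simplex_chart_dom.
    move=> q' Dq'; have := pmax _ (simplex_csimplex (chart_simplex m0 Dq')).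
    by rewrite chartK /in_chart chart_projK//; case: sp.
  have := @legendre_ge _ _ m0 psi hpsi s y p cp; rewrite psip mulr0.
  by rewrite {2}/legendre -/p psip mulr0.
have h := @area_upper R m D (const_mx (1 / 2)) (1 / 2) G (hessian f) f g
  (@chart_dom_open R m) half_gt0 (@chart_dom_unit_cube R m)
  (@grad_strict_diff _ _ psi hC2) (@det_hessian_continuous _ _ psi hC2)
  (@in_chart_continuous _ _ psi hC2) f_ge0 gm g0 gf gD.
apply: (@le_trans _ _ ((1 - s)%:E * \int[leb m]_y (g y)%:E)%E); last first.
  by apply: lee_wpmul2l => //; rewrite lee_fin ltW.
rewrite -ge0_integralZl//=; last 3 first.
- exact/measurable_EFinP.
- by move=> y _; rewrite lee_fin.
- by rewrite lee_fin ltW.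
rewrite le_eqVlt; apply/orP; left; apply/eqP; apply: eq_integral => y _.
by rewrite -EFinM /g mulrCA divff ?mulr1// gt_eqF.
Qed.

Lemma legendre_lower s : 1 < s ->
  ((s - 1)%:E * beta <= \int[leb m]_y (L s y - L 1 y)%:E)%E.
Proof.
move=> s1; have s1' : 0 < s - 1 by rewrite subr_gt0.
pose g y := (L s y - L 1 y) / (s - 1).
have gm : measurable_fun setT g.
  apply: measurable_funM => //; apply: measurable_funB; exact: legendre_measurable.
have g0 y : 0 <= g y.
  rewrite divr_ge0 ?(ltW s1')// subr_ge0.
  by apply: legendre_le; exact: ltW.
have fg q : D q -> f q <= g (G q).
  move=> Dq; rewrite /g ler_pdivlMr// legendre1_grad//.
  by have := legendre_grad m0 hpsi s Dq; rewrite -/f; lra.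
have h := @area_lower R m D (const_mx (1 / 2)) (1 / 2) G (hessian f) f g
  (@chart_dom_open R m) half_gt0 (@chart_dom_unit_cube R m)
  (@grad_strict_diff _ _ psi hC2) (@det_hessian_continuous _ _ psi hC2)
  (@in_chart_continuous _ _ psi hC2) f_ge0 gm g0.
apply: (@le_trans _ _ ((s - 1)%:E * \int[leb m]_y (g y)%:E)%E).
  apply: lee_wpmul2l; first by rewrite lee_fin ltW.
  apply: h => [q q' [Dq dq] [Dq' _]|q [Dq _]]; last exact: fg.
  by apply: (grad_injective m0 hpsi hC2) => //; rewrite -normr_eq0.
rewrite -ge0_integralZl//=; last 3 first.
- exact/measurable_EFinP.
- by move=> y _; rewrite lee_fin.
- by rewrite lee_fin ltW.
rewrite le_eqVlt; apply/orP; left; apply/eqP; apply: eq_integral => y _.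
by rewrite -EFinM /g mulrCA divff ?mulr1// gt_eqF.
Qed.

Let V := leb n (Rhat psi).

Let volume_legendre s : 0 < s ->
  ((s ^+ n)%:E * V = \int[leb m]_y (L s y - L 0 y)%:E)%E.
Proof. by move=> s0; rewrite -Rhat_scale// (volume_Rhat m0 hpsi (ltW s0)). Qed.

Let volume_legendre1 : (V = \int[leb m]_y (L 1 y - L 0 y)%:E)%E.
Proof. by rewrite -volume_legendre// expr1n mul1e. Qed.

Let split_integral a b c : a <= b -> b <= c ->
  (\int[leb m]_y (L c y - L a y)%:E =
   \int[leb m]_y (L c y - L b y)%:E +
   \int[leb m]_y (L b y - L a y)%:E)%E.
Proof.
move=> ab bc; rewrite -ge0_integralD//.
- by apply: eq_integral => y _; rewrite -EFinD addrA subrK.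
- by move=> y _; rewrite lee_fin subr_ge0 legendre_le.
- by apply/measurable_EFinP/measurable_funB; exact: legendre_measurable.
- by move=> y _; rewrite lee_fin subr_ge0 legendre_le.
- by apply/measurable_EFinP/measurable_funB; exact: legendre_measurable.
Qed.

Lemma volume_upper s : 0 < s < 1 -> (V <= (1 - s)%:E * beta + (s ^+ n)%:E * V)%E.
Proof.
move=> /andP[s0 s1]; rewrite [leLHS]volume_legendre1 (split_integral (ltW s0) (ltW s1)).
by rewrite -(volume_legendre s0) leeD2r// legendre_upper// (ltW s0).
Qed.

Lemma volume_lower s : 1 < s -> ((s - 1)%:E * beta + V <= (s ^+ n)%:E * V)%E.
Proof.
move=> s1; have s0 : 0 < s by apply: lt_trans s1.
rewrite volume_legendre// (split_integral ler01 (ltW s1)).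
by rewrite -volume_legendre1 leeD2r// legendre_lower.
Qed.

Lemma volume_le_beta : (V <= beta)%E.
Proof.
rewrite volume_legendre1; apply: le_trans (@legendre_upper 0 _) _.
  by rewrite lexx ltr01.
by rewrite subr0 mul1e.
Qed.

(** Divide by 1 - s or s - 1: the quotient of powers is the geometric sum of
    the s^i, close to n for s close to 1. *)
Lemma squeeze_powers (v b : R) : 0 <= v ->
  (forall s, 0 < s < 1 -> v <= (1 - s) * b + s ^+ n * v) ->
  (forall s, 1 < s -> (s - 1) * b + v <= s ^+ n * v) -> b = n%:R * v.
Proof.
move=> v0 vb bv.
have near (a : R) e : 0 < e -> exists2 x, 0 < x < 1 &
    `|v * \sum_(i < n) (1 + a * x) ^+ i - n%:R * v| <= e.
  move=> e0; have [d d0 h] := poly_near0 (v%:P * \sum_(i < n) (1 + a *: 'X) ^+ i) e0.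
  exists (Num.min d (1 / 2)).
    by rewrite lt_min d0 half_gt0/= gt_min; apply/orP; right; lra.
  have := h (Num.min d (1 / 2)); rewrite le_min (ltW d0) (ltW half_gt0) ge_min lexx.
  rewrite !hornerE !horner_sum => /(_ isT).
  under eq_bigr do rewrite !hornerE.
  under [X in _ - v * X]eq_bigr do rewrite !hornerE ?mulr0 ?addr0 expr1n.
  by rewrite sumr_const card_ord mulr_natr mulr_natl.
have geom (s : R) : s ^+ n - 1 = (s - 1) * \sum_(i < n) s ^+ i by rewrite subrX1.
apply/eqP; rewrite eq_le; apply/andP; split; apply/ler_addgt0Pr => e e0.
  have [x /andP[x0 x1]] := near 1 e e0; rewrite mul1r ler_norml => /andP[_ h].
  have := bv (1 + x); rewrite ltrDl => /(_ x0).
  rewrite -lerBrDr (_ : _ - v = x * (v * \sum_(i < n) (1 + x) ^+ i)); last first.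
    have := geom (1 + x); rewrite [1 + x - 1]addrAC subrr add0r => /eqP.
    by rewrite subr_eq => /eqP ->; ring.
  by rewrite [1 + x - 1]addrAC subrr add0r ler_pM2l//; lra.
have [x /andP[x0 x1]] := near (- 1) e e0; rewrite mulN1r ler_norml => /andP[h _].
have := vb (1 - x); rewrite subr_gt0 x1 gtrBl x0 => /(_ isT).
rewrite opprB [1 + (x - 1)]addrC subrK -lerBlDr.
rewrite (_ : v - _ = x * (v * \sum_(i < n) (1 - x) ^+ i)); last first.
  have := geom (1 - x); rewrite addrAC subrr add0r => /eqP.
  by rewrite subr_eq => /eqP ->; ring.
by rewrite ler_pM2l//; lra.
Qed.

Lemma volume_formula : (V = (n%:R^-1)%:E * beta)%E.
Proof.
have V0 : (0 <= V)%E by exact: measure_ge0.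
have beta0 : (0 <= beta)%E.
  by apply: integral_ge0 => q Dq; rewrite lee_fin mulr_ge0// f_ge0.
have n0 : 0 < n%:R^-1 :> R by rewrite invr_gt0 ltr0Sn.
have [VE|Vfin] := eqVneq V +oo%E.
  have -> : beta = +oo%E by apply/eqP; rewrite -leye_eq -VE volume_le_beta.
  by rewrite gt0_muley.
have {}Vfin : V \is a fin_num by rewrite ge0_fin_numE// lt_neqAle Vfin leey.
have bfin : beta \is a fin_num.
  rewrite ge0_fin_numE//; apply: (@le_lt_trans _ _ ((2 ^+ n)%:E * V)%E).
    have := @volume_lower 2 ltac:(lra); rewrite (_ : 2 - 1 = 1) ?mul1e; last by ring.
    by apply: le_trans; rewrite leeDl.
  by rewrite -(fineK Vfin) -EFinM ltry.
rewrite -(fineK Vfin) -(fineK bfin) -EFinM; congr EFin.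
have := @squeeze_powers (fine V) (fine beta) (fine_ge0 V0).
move=> ->; first by rewrite mulrA mulVf ?mul1r// pnatr_eq0.
- move=> s s01; have := volume_upper s01.
  by rewrite -(fineK Vfin) -(fineK bfin) -!EFinM -EFinD lee_fin.
- move=> s s1; have := volume_lower s1.
  by rewrite -(fineK Vfin) -(fineK bfin) -!EFinM -EFinD lee_fin.
Qed.

End volume_bounds.

Theorem theorem4p8 (R : realType) (n : nat) (hn : (2 <= n)%N)
    (psi : 'rV[R]_n -> R) (hpsi : classC psi)
    (hC2 : C2on (chart_dom n.-1) (in_chart psi))
    (hbd : forall p, bsimplex n p -> psi p = 0) :
  lebesgue_rV n (Rhat psi) =
  ((n%:R^-1)%:E *
   \int[lebesgue_rV n.-1]_(q in chart_dom n.-1)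
     (in_chart psi q * \det (- hessian (in_chart psi) q))%:E)%E.
Proof.
case: n hn psi hpsi hC2 hbd => // m hm psi hpsi hC2 hbd.
rewrite (volume_formula (hm : (0 < m)%N) hpsi hC2 hbd); congr (_ * _)%E.
by apply: eq_integral => q /set_mem Dq; rewrite (det_hessian (hm : (0 < m)%N) hpsi hC2 Dq).
Qed.
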